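(* (1) The only solutions of the equation $1+2x^p=U_{n}(x,y)^{q}$ in positive integers $n,p,q,x$ and with $y\in\{1,-1\}$ are $$(n,p,q,x,y)=(4,p,1,1,-1),\ (1+2^{p+1},p,1,2,1),\ (3,2,2,2,1),\ (3,1,1,2,-1)\ \text{ and }\ (5,3,1,3,1),$$ where in the first two families $p$ is an arbitrary positive integer. (2) Moreover, suppose that $n,k,p,q,x$ are positive integers with $\max\{p,q\}\leq 11$ and $k\geq 3$, and that $y\in\{1,-1\}$, with $x\geq 2$ when $y=-1$ and $x\geq 3$ when $y=1$. Then the equation $$\sum_{j=1}^{k}jU_{j}(x,y)^{p}=U_{n}(x,y)^{q}$$ has no solutions.
   Context: For integers $x,y$, the Lucas sequence of the first kind $\{U_n(x,y)\}$ is defined by $U_0(x,y)=0$, $U_1(x,y)=1$ and $U_{n+1}(x,y)=xU_n(x,y)-yU_{n-1}(x,y)$. Equivalently (when the roots are distinct), $U_n(x,y)=\frac{\alpha^n-\beta^n}{\alpha-\beta}$, where $\alpha,\beta$ are the roots of $t^2-xt+y$. *)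

(* Defs.v *)
From mathcomp Require Import all_boot all_order all_algebra.

Set Implicit Arguments.
Unset Strict Implicit.
Unset Printing Implicit Defensive.

Import GRing.Theory Num.Theory.

Local Open Scope ring_scope.

Fixpoint lucasU (x y : int) (n : nat) : int :=
  if n is n'.+1 then
    if n' is n''.+1 then x * lucasU x y n' - y * lucasU x y n'' else 1
  else 0.

(* Main.v *)
Require Import Defs.
From Stdlib Require Import ZArith MSetPositive.
From mathcomp Require Import all_boot all_order all_algebra.
From mathcomp Require Import zify ring lra ssrZ realalg.

Set Implicit Arguments.
Unset Strict Implicit.
Unset Printing Implicit Defensive.

Import Order.TTheory GRing.Theory Num.Theory.

Local Open Scope ring_scope.

(** Everything starts from two congruences: U_(2m) is m x up to sign modulo x^3,
and U_(2m+1) is 1 up to sign modulo x^2 (lucasU_mod_sq).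

The equation 1 + 2 x^p = U_n^q. An even n would make x divide 1, so U_n is 1 up
to sign modulo x^2. If r is an odd prime factor of q and v = U_n^(q/r), the odd
number (v^r - 1) / (v - 1) divides 2 x^p and is r modulo x^2; hence it divides r,
although it is larger (no_odd_power). If q is even, a similar argument on the two
factors of U_n^q - 1 leaves nothing (even_square_cases). So q = 1, and
U_(2m+1) - 1 is a product of some U_j and some V_r with r odd, where V is the
companion sequence. For a prime s dividing r the integer V_s / x divides 2 x^p
and is s up to sign modulo x^2, and the same argument leaves only the listed
solutions (odd_lucasV_dvd). The pairs (x, y) = (1, -1), (1, 1), (2, 1) give the
Fibonacci numbers, a periodic sequence and the integers.

The equation sum_j j U_j^p = U_n^q. Let al > 1 and be be the two roots and
g = al^p. Replacing every U_j by al^j / (al - be) turns the equation into the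
statement that one explicit element of Z[al], called norm_form, is tiny compared
with its two terms (form_bound), while its conjugate is small as well
(conj_form_bound). It is not zero (norm_form_neq0): if it were, either
k (g - 1) - 1 or g - 1 would divide a unit. So its norm is a nonzero integer, and
comparing sizes bounds k by 240 / p + p, whatever x is (index_bound).

When x >= 20, the same estimate is so sharp that it forces k = x, or k = x - 1
if p = 1, and determines n q (large_x_index). The sum is then an explicit
quadratic expression modulo x^2, which no U_n^q matches (no_large_x). When
x <= 19 the remaining cases are finitely many sums, and for each x one modulus M
separates all of them from all powers U_n^q, whose residues modulo M form a
short periodic list (no_small_x). *)

(** * Lucas sequences and their companions *)

Lemma lucasUSS x y n :
  lucasU x y n.+2 = x * lucasU x y n.+1 - y * lucasU x y n.
Proof. by []. Qed.

Lemma lucasUD x y m n :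
  lucasU x y (m + n).+1
  = lucasU x y m.+1 * lucasU x y n.+1 - y * lucasU x y m * lucasU x y n.
Proof.
elim/ltn_ind: n => -[|[|n]] IH.
- by rewrite addn0 /= mulr1 mulr0 subr0.
- by rewrite addn1 lucasUSS /=; ring.
have := IH n.+1 (ltnSn _); have := IH n (leqnSn _).
by rewrite !addnS => h0 h1; rewrite lucasUSS h1 h0 !lucasUSS; ring.
Qed.

Lemma lucasUDr x y m n :
  lucasU x y (m + n)
  = lucasU x y m.+1 * lucasU x y n + lucasU x y m * lucasU x y n.+1
    - x * lucasU x y m * lucasU x y n.
Proof.
case: m => [|m]; first by rewrite add0n /=; ring.
rewrite addSn lucasUD lucasUSS; ring.
Qed.

Lemma lucasU_cassini x y n :
  lucasU x y n.+1 ^+ 2 - x * lucasU x y n.+1 * lucasU x y n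
  + y * lucasU x y n ^+ 2 = y ^+ n.
Proof.
elim: n => [|n IH]; first by rewrite /=; ring.
by rewrite (exprS y) -IH lucasUSS; ring.
Qed.

(** The companion sequence al^n + be^n. *)
Definition lucasV (x y : int) (n : nat) : int :=
  2 * lucasU x y n.+1 - x * lucasU x y n.

(** With lucasU_odd_add, the factorization of U_(2m+1) - 1: the sign of y^m tells
which of the two applies, and either way one factor is V at an odd index when
y = -1, or when y = 1 and m is even. *)
Lemma lucasU_odd_sub x y m :
  lucasU x y m * lucasV x y m.+1 = lucasU x y m.*2.+1 - y ^+ m.
Proof.
rewrite -addnn lucasUD -(lucasU_cassini x y m) /lucasV lucasUSS; ring.
Qed.

Lemma lucasU_odd_add x y m :
  lucasU x y m.+1 * lucasV x y m = lucasU x y m.*2.+1 + y ^+ m.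
Proof.
rewrite -addnn lucasUD -(lucasU_cassini x y m) /lucasV; ring.
Qed.

Lemma lucasV_mul x y m n :
  lucasV x y (m + n) * lucasV x y n
  = lucasV x y (m + n + n) + y ^+ n * lucasV x y m.
Proof.
rewrite /lucasV !(lucasUD, lucasUDr) -(lucasU_cassini x y n); ring.
Qed.

(** By lucasV_mul, V_(s (t + 2)) and - y^s V_(s t) agree modulo V_s. *)
Lemma lucasV_dvd_odd x y s t : odd t -> (lucasV x y s %| lucasV x y (s * t))%Z.
Proof.
move=> todd; rewrite -(odd_double_half t) todd add1n.
elim: t./2 => [|i IH].
  by rewrite muln1.
have -> : (s * i.+1.*2.+1 = s * i.*2.+1 + s + s)%N.
  by rewrite doubleS -addn1 -addn1; lia.
have <- : lucasV x y (s * i.*2.+1 + s) * lucasV x y s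
          - y ^+ s * lucasV x y (s * i.*2.+1)
          = lucasV x y (s * i.*2.+1 + s + s).
  by rewrite lucasV_mul; ring.
by rewrite rpredB ?dvdz_mull.
Qed.

Lemma lucasU_mod_sq x y m : y * y = 1 ->
  (exists t, lucasU x y m.*2 = (- y) ^+ m.+1 * m%:Z * x + t * x ^+ 3) /\
  (exists t, lucasU x y m.*2.+1 = (- y) ^+ m + t * x ^+ 2).
Proof.
move=> y2; have y2' i : (- y) ^+ i.+2 = (- y) ^+ i.
  by rewrite !exprS mulrA mulrNN y2 mul1r.
elim: m => [|m [[s IHs] [t IHt]]].
  by split; exists 0; rewrite /=; ring.
have E : exists t, lucasU x y m.+1.*2 = (- y) ^+ m.+2 * m.+1%:Z * x + t * x ^+ 3.
  exists (t - y * s); rewrite doubleS lucasUSS IHs IHt.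
  rewrite y2' (exprS (- y) m) intS.
  have -> : y * (- y * (- y) ^+ m * m%:Z * x + s * x ^+ 3)
      = - (y * y) * (- y) ^+ m * m%:Z * x + y * s * x ^+ 3 by ring.
  by rewrite y2; ring.
split=> //; case: E => u E.
exists ((- y) ^+ m.+2 * m.+1%:Z + u * x ^+ 2 - y * t).
by rewrite doubleS lucasUSS -doubleS E IHt (exprS (- y) m); ring.
Qed.

(** The pairs for which U at least doubles at each step (lucasU_growth). Among
positive x and y = 1 or -1 this leaves out only (1, -1), (1, 1) and (2, 1). *)
Definition lucas_range (x y : int) : Prop :=
  (y = -1 /\ 2 <= x) \/ (y = 1 /\ 3 <= x).

Lemma lucas_range_sq x y : lucas_range x y -> y * y = 1.
Proof. by move=> [[-> _]|[-> _]]. Qed.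

Lemma lucasU_growth x y n : lucas_range x y ->
  0 <= lucasU x y n /\ 2 * lucasU x y n <= lucasU x y n.+1.
Proof.
move=> xy; elim: n => [|n [IH0 IH]]; first by rewrite /=; lia.
rewrite lucasUSS; move: xy IH0 IH.
set u := lucasU x y n; set v := lucasU x y n.+1.
by move=> [[-> hx]|[-> hx]] h0 h; split; nia.
Qed.

Lemma lucasU_gt0 x y n : lucas_range x y -> (0 < n)%N -> 0 < lucasU x y n.
Proof.
move=> xy; case: n => // n _; elim: n => [|n IH] //.
by have := lucasU_growth n.+1 xy; lia.
Qed.

(** * Divisors of 2 x^p *)

Lemma coprimez_unit_mod (e w x c : int) : e * e = 1 -> w = e + c * x -> coprimez w x.
Proof.
by move=> ee ->; apply/coprimezP; exists (e, - e * c); rewrite -ee /=; ring.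
Qed.

(** If s does not divide x, then N is prime to x; if it does, then N / s is
1 up to sign modulo x, hence prime to x. And a divisor of
2 x^p that is prime to x divides 2. *)
Lemma dvd_power_prime_mod (N x e t : int) (s p : nat) :
  prime s -> e * e = 1 -> N = e * s%:Z + t * x ^+ 2 -> (N %| 2 * x ^+ p)%Z ->
  (N %| 2)%Z \/ (s%:Z %| x)%Z /\ (N %| 2 * s%:Z)%Z.
Proof.
move=> s_pr ee defN dvN; case: (boolP (s%:Z %| x)%Z) => [/dvdzP[z xE]|sNx].
  right; split=> //.
  pose w := e + t * z * x.
  have NE : N = w * s%:Z by rewrite defN /w xE; ring.
  have cwx : coprimez w x by apply: (coprimez_unit_mod ee).
  have : (w %| 2 * x ^+ p)%Z by apply: dvdz_trans dvN; rewrite NE dvdz_mulr.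
  by rewrite Gauss_dvdzl ?coprimezXr // NE => dw; rewrite dvdz_mul.
left; rewrite Gauss_dvdzl // in dvN; apply: coprimezXr.
have : coprimez s%:Z x by rewrite coprimezE prime_coprime.
move=> /coprimezP[[u v] /= uv]; apply/coprimezP.
exists (u * e, v - u * e * t * x); rewrite /= defN -uv.
have -> : u * e * (e * s%:Z + t * x ^+ 2) + (v - u * e * t * x) * x
   = (e * e) * u * s%:Z + v * x by ring.
by rewrite ee mul1r.
Qed.

Lemma dvdz_sumX_sub (d v : int) (r : nat) :
  (d %| v - 1)%Z -> (d %| \sum_(i < r) v ^+ i - r%:Z)%Z.
Proof.
move=> dv; elim: r => [|r IH]; first by rewrite big_ord0 subr0.
rewrite big_ord_recr /= intS.
have -> (a b c : int) : a + b - (1 + c) = (a - c) + (b - 1) by ring.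
by rewrite rpredD // subrX1 dvdz_mulr.
Qed.

(** The cofactor N = 1 + v + ... + v^(r-1) of v^r - 1 is r modulo x^2, so
dvd_power_prime_mod makes it a divisor of 2 r; being odd, it divides r, but
N > r. *)
Lemma no_odd_power (x v : int) (r p : nat) :
  prime r -> odd r -> 1 < v -> (x ^+ 2 %| v - 1)%Z -> 1 + 2 * x ^+ p <> v ^+ r.
Proof.
move=> r_pr r_odd v1 dv E.
have v_odd : (2 %| v - 1)%Z.
  have : (2 %| v - 1)%Z || (2 %| v)%Z by lia.
  case/orP => // h; have : (2 %| v ^+ r)%Z.
    by rewrite -(prednK (prime_gt0 r_pr)) exprS dvdz_mulr.
  by rewrite -E rpredDr ?dvdz_mulr.
set N : int := \sum_(i < r) v ^+ i.
have N_gt : r%:Z < N.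
  have r2 : (1 < r)%N by apply: prime_gt1.
  rewrite /N -(prednK (prime_gt0 r_pr)) big_ord_recl /= expr0 intS ltrD2l.
  have -> : r.-1%:Z = \sum_(i < r.-1) 1 by rewrite sumr_const card_ord natz.
  apply: ltr_sum => [|i _]; last by rewrite exprn_egt1.
  by apply/hasP; exists (Ordinal (n:=r.-1) (m:=0) (ltac:(lia))); rewrite ?mem_index_enum.
have /dvdzP[t Nt] : (x ^+ 2 %| N - r%:Z)%Z by apply: dvdz_sumX_sub.
have N_odd : (2 %| N - 1)%Z.
  have -> : N - 1 = (N - r%:Z) + (r%:Z - 1) by ring.
  rewrite rpredD ?dvdz_sumX_sub //.
  apply/dvdzP; exists (r./2)%:Z; rewrite -{1}(odd_double_half r) r_odd add1n -mul2n.
  by rewrite intS PoszM; ring.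
have dvN : (N %| 2 * x ^+ p)%Z.
  have -> : 2 * x ^+ p = v ^+ r - 1 by rewrite -E; ring.
  by rewrite subrX1 dvdz_mull.
have cN2 : coprimez N 2.
  by have /dvdzP[c Nc] := N_odd; apply: (@coprimez_unit_mod 1 _ _ c); rewrite -?Nc //; ring.
have : (N %| 2 * r%:Z)%Z.
  case: (@dvd_power_prime_mod N x 1 t r p r_pr (mulr1 1) _ dvN) => [||[]] //.
    by rewrite -Nt; ring.
  by move=> ?; rewrite dvdz_mulr.
rewrite Gauss_dvdzr // dvdzE => /dvdn_leq.
by rewrite prime_gt0 // => /(_ isT); move: N_gt; clearbody N; clear; lia.
Qed.

(** Since x is even, half of v + e is e modulo x, hence prime to x, but it divides
x^p: so v + e is 2 up to sign. *)
Lemma even_square_cases (x v e : int) (p : nat) :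
  (0 < p)%N -> 0 < x -> 0 < v -> e = 1 \/ e = -1 -> (x ^+ 2 %| v - e)%Z ->
  1 + 2 * x ^+ p = v ^+ 2 -> v = 3 /\ e = -1.
Proof.
move=> p0 x0 v0 e1 /dvdzP[c vE] E.
have xp0 : 0 < x ^+ p by rewrite exprn_gt0.
have x_even : (2 %| x)%Z.
  have : (2 %| x ^+ p)%Z.
    have [w [vw|vw]] : exists w, v = 2 * w \/ v = 2 * w + 1.
      by exists (v %/ 2)%Z; lia.
      by move: E; rewrite vw; lia.
    have E' : x ^+ p = 2 * (w * (w + 1)).
      by apply: (@mulfI _ 2) => //; move: E; rewrite vw; lia.
    by rewrite E' dvdz_mulr.
  by rewrite !dvdzE abszX Euclid_dvdX // => /andP[].
have /dvdzP[z xE] := x_even.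
pose w := e + c * z * x.
have wE : v + e = 2 * w.
  have -> : v + e = (v - e) + 2 * e by ring.
  by rewrite vE /w xE; ring.
have ee : e * e = 1 by case: e1 => ->.
have cw : coprimez w x by apply: (coprimez_unit_mod ee).
have : (w %| x ^+ p * 1)%Z.
  apply/dvdzP; exists (v - e); apply: (@mulfI _ 2) => //.
  rewrite [RHS]mulrCA.
  have -> : (v - e) * (2 * w) = v ^+ 2 - e * e by rewrite -wE; ring.
  by rewrite -E ee; ring.
rewrite Gauss_dvdzr ?coprimezXr // dvdz1 => w1.
have {}w1 : w = 1 \/ w = -1 by clearbody w; lia.
by case: e1 => e1; split => //; lia.
Qed.

Lemma lucasV_odd_mod x y i : y * y = 1 ->
  exists2 w, lucasV x y i.*2.+1 = w * x &
  exists t, w = (- y) ^+ i * (i.*2.+1)%:Z + t * x ^+ 2.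
Proof.
move=> y2; have [_ [s Us]] := lucasU_mod_sq x i y2.
have [[t Ut] _] := lucasU_mod_sq x i.+1 y2.
exists ((- y) ^+ i * (i.*2.+1)%:Z + (2 * t - s) * x ^+ 2); last by eexists.
rewrite /lucasV -doubleS Us Ut !exprS -mul2n !intS PoszM.
have -> : - y * (- y * (- y) ^+ i) = (y * y) * (- y) ^+ i by ring.
by rewrite y2; ring.
Qed.

Lemma lucasVSS x y n : lucasV x y n.+2 = x * lucasV x y n.+1 - y * lucasV x y n.
Proof. by rewrite /lucasV !lucasUSS; ring. Qed.

Lemma lucasV_mono x y n : lucas_range x y ->
  0 < lucasV x y n /\ lucasV x y n <= lucasV x y n.+1.
Proof.
move=> xy; elim: n => [|n [IH0 IH]].
  by rewrite /lucasV lucasUSS /=; case: xy => -[-> h]; split; lia.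
rewrite lucasVSS; move: IH0 IH.
set u := lucasV x y n; set v := lucasV x y n.+1 => h0 h.
by case: xy => -[-> hx]; split; nia.
Qed.

Lemma lucasV_ge3 x y n : lucas_range x y -> (3 <= n)%N ->
  x * (x ^+ 2 - 3 * y) <= lucasV x y n.
Proof.
move=> xy; elim: n => // n IH; rewrite leq_eqVlt => /orP[/eqP<-|h].
  by rewrite /lucasV !lucasUSS /= le_eqVlt; apply/orP; left; apply/eqP; ring.
by apply: le_trans (IH h) _; have [] := lucasV_mono n xy.
Qed.

(** V_s / x is s up to sign modulo x^2, so dvd_power_prime_mod bounds it by 2 s,
with s <= x when it exceeds 2; but V_s / x is at least x^2 - 3 y. The only
survivor is V_3 / x = 6 at x = 3, y = 1. *)
Lemma prime_lucasV_dvd x y s p : lucas_range x y -> prime s -> odd s ->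
  (lucasV x y s %| 2 * x ^+ p)%Z -> [/\ s = 3%N, x = 3 & y = 1].
Proof.
move=> xy s_pr s_odd dV; have y2 := lucas_range_sq xy.
have s3 : (3 <= s)%N.
  by have := prime_gt1 s_pr; rewrite leq_eqVlt => /orP[/eqP s2|//]; move: s_odd; rewrite -s2.
have x0 : 0 < x by case: xy => -[]; lia.
have [w Vw [t wE]] := lucasV_odd_mod x s./2 y2.
have sE : s./2.*2.+1 = s by rewrite -[RHS]odd_double_half s_odd add1n.
rewrite sE in Vw wE.
have w_ge : x ^+ 2 - 3 * y <= w.
  by rewrite -(ler_pM2l x0) (mulrC x w) -Vw lucasV_ge3.
have w6 : 6 <= w by case: xy w_ge => -[-> h]; nia.
have dw : (w %| 2 * x ^+ p)%Z by apply: dvdz_trans dV; rewrite Vw dvdz_mulr.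
have ee : (- y) ^+ s./2 * (- y) ^+ s./2 = 1 by rewrite -exprMn mulrNN y2 expr1n.
have dle (a b : int) : 0 < b -> (a %| b)%Z -> a <= b.
  by move=> b0; rewrite dvdzE => /dvdn_leq; lia.
case: (dvd_power_prime_mod s_pr ee wE dw) => [/dle|[/dle sx /dle]]; first by lia.
move/(_ ltac:(lia)) => ws; move: (sx x0) => {}sx.
have s3' : s = 3%N.
  apply/eqP; rewrite eqn_leq s3 andbT leqNgt; apply/negP => s4.
  by case: xy w_ge => -[-> h]; move: s4 sx ws h; clear; nia.
by subst s; case: xy w_ge => -[-> h]; move: sx ws h; clear; split=> //; nia.
Qed.

(** Each prime factor of r satisfies the same hypothesis, so it is 3 and x = 3,
y = 1; and 9 does not divide r because V_9(3, 1) has the prime factor 107. *)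
Lemma odd_lucasV_dvd x y r p : lucas_range x y -> odd r -> (1 < r)%N ->
  (lucasV x y r %| 2 * x ^+ p)%Z -> [/\ r = 3%N, x = 3 & y = 1].
Proof.
move=> xy r_odd r1 dV.
have sub d : (d %| r)%N -> (lucasV x y d %| 2 * x ^+ p)%Z.
  move=> /dvdnP[t rE]; apply: dvdz_trans dV; rewrite rE mulnC.
  by apply: lucasV_dvd_odd; move: r_odd; rewrite rE oddM => /andP[].
have key s : prime s -> (s %| r)%N -> [/\ s = 3%N, x = 3 & y = 1].
  move=> s_pr sr; apply: (prime_lucasV_dvd (p := p)) => //; last exact: sub.
  exact: dvdn_odd r_odd.
have [p3 x3 y1] := key _ (pdiv_prime r1) (pdiv_dvd r).
split=> //; have := pdiv_dvd r; rewrite p3 => /dvdnP[t rE].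
have [t1|t1] := leqP t 1; first by move: r1; rewrite rE; lia.
have tr : (t %| r)%N by rewrite rE dvdn_mulr.
have [p3' _ _] := key _ (pdiv_prime t1) (dvdn_trans (pdiv_dvd t) tr).
have /dvdnP[u tE] := pdiv_dvd t; rewrite p3' in tE.
have : (lucasV x y 9 %| 2 * x ^+ p)%Z by apply: sub; rewrite rE tE -mulnA dvdn_mull.
have -> : lucasV x y 9 = 107 * 54 by rewrite x3 y1.
move=> d; have : (107 %| 2 * x ^+ p)%Z by apply: dvdz_trans d; rewrite dvdz_mulr.
by rewrite dvdzE abszM abszX x3 Euclid_dvdM // Euclid_dvdX.
Qed.

(** * The equation 1 + 2 x^p = U_n^q *)

Lemma power_eq_range (n p q : nat) (x y : int) :
  lucas_range x y -> (0 < n)%N -> (0 < p)%N -> (0 < q)%N ->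
  1 + 2 * x ^+ p = lucasU x y n ^+ q ->
  (n, p, q, x, y) = (3%N, 1%N, 1%N, 2, -1) \/
  (n, p, q, x, y) = (5%N, 3%N, 1%N, 3, 1).
Proof.
move=> xy n0 p0 q0 E; have y2 := lucas_range_sq xy.
have x2 : 2 <= x by case: xy => -[]; lia.
have xp0 : 0 < x ^+ p by rewrite exprn_gt0 //; lia.
have xdp : (x %| 2 * x ^+ p)%Z by rewrite -(prednK p0) exprS mulrCA dvdz_mulr.
have ndvd (a : int) : (x %| a)%Z -> 0 < a -> x <= a.
  by move=> + a0; rewrite dvdzE => /dvdn_leq; lia.
have U0 := lucasU_gt0 xy n0.
(* An even n would make x divide 1. *)
case: (boolP (odd n)) => n_odd; last first.
  have [m nE] : exists m, n = m.*2 by exists n./2; rewrite -[LHS]odd_double_half (negbTE n_odd).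
  have [[t Ut] _] := lucasU_mod_sq x m y2.
  have : (x %| 1 + 2 * x ^+ p)%Z.
    rewrite E -(prednK q0) exprS dvdz_mulr // nE Ut.
    by rewrite rpredD ?dvdz_mull // exprS mulrCA dvdz_mulr.
  by rewrite rpredDr // => /ndvd; lia.
have [m nE] : exists m, n = m.*2.+1 by exists n./2; rewrite -[LHS]odd_double_half n_odd.
have [_ [t]] := lucasU_mod_sq x m y2; rewrite -nE; set e := (- y) ^+ m => Ut.
have e1 : e = 1 \/ e = -1.
  by rewrite /e; case: xy => -[-> _]; rewrite ?opprK ?expr1n; [left|rewrite -signr_odd; case: odd; [right|left]].
have dU k : (x ^+ 2 %| lucasU x y n ^+ k - e ^+ k)%Z.
  by rewrite subrXX dvdz_mulr // Ut addrAC subrr add0r dvdz_mull.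
case: (boolP (odd q)) => q_odd; last first.
  have qE : q = (q./2 * 2)%N by rewrite muln2 -[LHS]odd_double_half (negbTE q_odd).
  have ek : e ^+ q./2 = 1 \/ e ^+ q./2 = -1.
    by case: e1 => ->; rewrite ?expr1n; [left|rewrite -signr_odd; case: odd; [right|left]].
  rewrite qE exprM in E.
  have [||v3 em] := even_square_cases p0 _ _ ek (dU _) E; [lia|by rewrite exprn_gt0|].
  have := dU q./2; rewrite v3 em.
  case: xy => -[yE x3]; first by move: em; rewrite /e yE opprK !expr1n.
  by rewrite dvdzE => /dvdn_leq; move: x3; clear; nia.
(* If U_n is -1 modulo x^2, an odd q gives -1 = 1 modulo x. *)
case: e1 => e1; last first.
  have := dU q; rewrite e1 -signr_odd q_odd -E => d.
  case: xy => -[yE x3]; first by move: e1; rewrite /e yE opprK expr1n.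
  have : (x %| 1 + 2 * x ^+ p - -1)%Z by apply: dvdz_trans d; rewrite exprS dvdz_mulr.
  have -> : 1 + 2 * x ^+ p - -1 = 2 + 2 * x ^+ p :> int by ring.
  by rewrite rpredDr // => /ndvd; lia.
case: (ltnP 1 q) => q1.
  have r_pr := pdiv_prime q1; have r_odd := dvdn_odd (pdiv_dvd q) q_odd.
  have := dU (q %/ pdiv q)%N; rewrite e1 expr1n => d.
  have qE : q = (q %/ pdiv q * pdiv q)%N by rewrite divnK ?pdiv_dvd.
  have U1 : 1 < lucasU x y n.
    rewrite ltNge; apply/negP => h; have Ue : lucasU x y n = 1 by lia.
    by move: E; rewrite Ue expr1n; lia.
  rewrite qE exprM in E; case: (no_odd_power r_pr r_odd _ d E).
  by rewrite exprn_egt1 // -lt0n divn_gt0 ?pdiv_gt0 // dvdn_leq // pdiv_dvd.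
have {}q1 : q = 1%N by lia.
subst q; rewrite expr1 in E; clear dU q0 q_odd.
have m0 : m != 0%N by apply/eqP => m0; move: E; rewrite nE m0 /=; lia.
have sub : ~~ odd m -> [/\ m.+1 = 3%N, x = 3 & y = 1].
  move=> m_even; apply: (odd_lucasV_dvd (p := p)) => //=; first by lia.
  have := lucasU_odd_sub x y m; rewrite -nE -E.
  have -> : y ^+ m = 1 by rewrite -(odd_double_half m) (negbTE m_even) -muln2 mulnC exprM expr2 y2 expr1n.
  by move=> h; apply/dvdzP; exists (lucasU x y m); rewrite h; ring.
case: (boolP (odd m)) => m_odd; last first.
  have [m3 x3 y1] := sub m_odd; right; have mE : m = 2%N by lia.
  move: E; rewrite nE mE x3 y1 => E.
  have : 3 ^+ p = 3 ^+ 3 :> int by move: E; rewrite /=; lia.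
  by move=> h; have -> : p = 3%N by apply: (@ieexprIn _ (3 : int)) h.
case: xy => -[yE xr]; last by move: e1; rewrite /e yE -signr_odd m_odd.
have xy : lucas_range x y by left.
have dV : (lucasV x y m %| 2 * x ^+ p)%Z.
  have ym : y ^+ m = -1 by rewrite yE -signr_odd m_odd.
  have := lucasU_odd_add x y m; rewrite -nE -E ym => h.
  by apply/dvdzP; exists (lucasU x y m.+1); rewrite h; ring.
have m1 : m = 1%N.
  apply/eqP; rewrite eqn_leq lt0n m0 andbT leqNgt; apply/negP => m1.
  by have [_ _] := odd_lucasV_dvd xy m_odd m1 dV; rewrite yE.
left; have E' : x * x = 2 * x ^+ p.
  have U3 : lucasU x (-1) 1.*2.+1 = x * x + 1 by rewrite /=; ring.
  by move: E; rewrite nE m1 yE U3; lia.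
case: p p0 E' {E xp0 xdp dV sub} => [|[|p]] // _; rewrite !exprS ?expr0 ?mulr1 => E'.
  have -> : x = 2 by apply: (@mulIf _ x) => //; lia.
  by rewrite nE m1 yE.
have xp : 0 < x ^+ p by rewrite exprn_gt0 //; lia.
have xx : 0 < x * x by rewrite mulr_gt0 //; lia.
have : x * x * (2 * x ^+ p - 1) = 0.
  by rewrite mulrBr mulr1 {2}E'; ring.
by move/eqP; rewrite mulf_eq0 => /orP[] /eqP; lia.
Qed.

Lemma fib_gt3 n : (5 <= n)%N -> 3 < lucasU 1 (-1) n /\ 0 < lucasU 1 (-1) n.-1.
Proof.
case: n => // n; elim: n => // n IH; rewrite leq_eqVlt => /orP[/eqP<-//|h].
by rewrite lucasUSS; have := IH h; rewrite /= ; lia.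
Qed.

Lemma power_eq_fib n p q : (0 < n)%N -> (0 < q)%N ->
  1 + 2 * 1 ^+ p = lucasU 1 (-1) n ^+ q -> n = 4%N /\ q = 1%N.
Proof.
rewrite expr1n => n0 q0 E.
have [n5|n5] := leqP 5 n.
  have [h _] := fib_gt3 n5; move: E; rewrite -(prednK q0) exprS.
  have : 1 <= lucasU 1 (-1) n ^+ q.-1 by rewrite exprn_ege1 //; lia.
  by move: h; set u := lucasU _ _ _; set v := _ ^+ _; clearbody u v; clear; nia.
move: E; case: n n0 n5 => [|[|[|[|[|]]]]] //= _ _; rewrite ?mulr1 ?subrr ?expr1n //.
  by rewrite -(prednK q0) exprS; lia.
case: q q0 => [|[|q]] // _; rewrite !exprS.
have : 1 <= 3 ^+ q :> int by rewrite exprn_ege1.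
by lia.
Qed.

Lemma lucasU_period6 n : lucasU 1 1 n \in [:: -1; 0; 1].
Proof.
suff : (lucasU 1 1 n, lucasU 1 1 n.+1) \in
  [:: (0,1); (1,1); (1,0); (0,-1); (-1,-1); (-1,0)].
  by rewrite !inE !xpair_eqE; lia.
elim: n => // n; rewrite lucasUSS !inE !xpair_eqE; lia.
Qed.

Lemma lucasU_id n : lucasU 2 1 n = n%:Z.
Proof.
elim/ltn_ind: n => -[|[|n]] // IH; rewrite lucasUSS !IH //; lia.
Qed.

Lemma power_eq_id (n p q : nat) : (0 < n)%N -> (0 < p)%N -> (0 < q)%N ->
  1 + 2 * 2 ^+ p = n%:Z ^+ q :> int ->
  (n, q) = ((1 + 2 ^ (p + 1))%N, 1%N) \/ (n, p, q) = (3%N, 2%N, 2%N).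
Proof.
move=> n0 p0 q0 E.
have X0 (k : nat) : 0 < n%:Z ^+ k :> int by rewrite exprn_gt0 //; lia.
have p4 : 2 * 2 ^+ p = 4 * 2 ^+ p.-1 :> int by rewrite -{1}(prednK p0) exprS; ring.
have mod4 k : (0 < k)%N -> (k %| q)%N -> (4 %| n%:Z ^+ k - 1)%Z \/ (4 %| n%:Z ^+ k - -1)%Z.
  move=> k0 kq; have : ~~ (2 %| n%:Z ^+ k)%Z.
    apply/negP => d; have : (2 %| n%:Z ^+ q)%Z.
      by rewrite -(divnK kq) mulnC exprM; apply: dvdz_exp; rewrite ?divn_gt0 // dvdn_leq.
    by rewrite -E; lia.
  by move: (n%:Z ^+ k) => u; lia.
case: (ltnP 1 q) => q1; last first.
  have q1' : q = 1%N by lia.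
  left; rewrite q1' expr1 in E *; congr (_, _); apply/eqP.
  by rewrite -eqz_nat -E addn1 PoszD -!natz natrX exprS.
case: (boolP (odd q)) => q_odd.
  have r_pr := pdiv_prime q1; have r_odd := dvdn_odd (pdiv_dvd q) q_odd.
  have qE : q = (q %/ pdiv q * pdiv q)%N by rewrite divnK ?pdiv_dvd.
  have k0 : (0 < q %/ pdiv q)%N by rewrite divn_gt0 ?pdiv_gt0 // dvdn_leq // pdiv_dvd.
  rewrite qE exprM in E.
  case: (mod4 _ k0 (dvdn_div (pdiv_dvd q))) => d.
    case: (no_odd_power (x := 2) r_pr r_odd _ d E).
    rewrite ltNge; apply/negP => h.
    have Ue : n%:Z ^+ (q %/ pdiv q) = 1 by have := X0 (q %/ pdiv q)%N; lia.
    have : 0 < 2 ^+ p :> int by rewrite exprn_gt0.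
    by move: E; rewrite Ue expr1n; lia.
  have : (4 %| (n%:Z ^+ (q %/ pdiv q)) ^+ pdiv q - (-1) ^+ pdiv q)%Z.
    by rewrite subrXX dvdz_mulr.
  by rewrite -E p4 -signr_odd r_odd expr1; lia.
have qE : q = (q./2 * 2)%N by rewrite muln2 -[LHS]odd_double_half (negbTE q_odd).
have k0 : (0 < q./2)%N by lia.
have kq : (q./2 %| q)%N by rewrite {2}qE dvdn_mulr.
have E2 : 1 + 2 * 2 ^+ p = (n%:Z ^+ q./2) ^+ 2 :> int by rewrite -exprM -qE.
have v3 : n%:Z ^+ q./2 = 3.
  by case: (mod4 _ k0 kq) => d;
     [have [|//] := @even_square_cases 2 _ 1 p p0 isT (X0 _) _ d E2; left
     |have [|//] := @even_square_cases 2 _ (-1) p p0 isT (X0 _) _ d E2; right].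
right; have h : 2 ^+ p = 2 ^+ 2 :> int by move: E2; rewrite v3; lia.
have -> : p = 2%N by apply: (@ieexprIn _ (2 : int)) h.
have n1 : 1 < n%:Z :> int.
  rewrite ltNge; apply/negP => n1; have n1' : n%:Z = 1 :> int by lia.
  by move: v3; rewrite n1' expr1n.
have k1 : q./2 = 1%N.
  case: (q./2) v3 k0 => [|[|k]] // v3 _; move: v3; rewrite !exprS.
  have := X0 k; move: n1; set u := n%:Z; set v := u ^+ k; clearbody v; clearbody u; clear; nia.
by move: v3; rewrite qE k1 expr1 => -[->].
Qed.

Lemma power_eq_solutions (n p q : nat) (x y : int) :
  (0 < n)%N -> (0 < p)%N -> (0 < q)%N -> 0 < x -> y = 1 \/ y = -1 ->
  (1 + 2 * x ^+ p = lucasU x y n ^+ q <->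
          (n, p, q, x, y) = (4%N, p, 1%N, 1, -1) \/
          (n, p, q, x, y) = ((1 + 2 ^ (p + 1))%N, p, 1%N, 2, 1) \/
          (n, p, q, x, y) = (3%N, 2%N, 2%N, 2, 1) \/
          (n, p, q, x, y) = (3%N, 1%N, 1%N, 2, -1) \/
          (n, p, q, x, y) = (5%N, 3%N, 1%N, 3, 1)).
Proof.
move=> n0 p0 q0 x0 y1; split; last first.
  case=> [[-> -> -> ->]|[[-> -> -> ->]|[[-> -> -> -> ->]|[[-> -> -> -> ->]|[-> -> -> -> ->]]]]] //.
    by rewrite expr1n.
  by rewrite lucasU_id expr1 PoszD addn1 -!natz natrX exprS.
move=> E.
have [xy|[[x1 ym]|[[x1 yp]|[x2 yp]]]] : lucas_range x y \/
    (x = 1 /\ y = -1) \/ (x = 1 /\ y = 1) \/ (x = 2 /\ y = 1).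
  by rewrite /lucas_range; lia.
- by do 3 right; apply: power_eq_range E.
- by left; move: E; rewrite x1 ym => /power_eq_fib[] // -> ->.
- have : lucasU 1 1 n ^+ q \in [:: -1; 0; 1].
    have := lucasU_period6 n; rewrite !inE => /or3P[] /eqP->.
    + by rewrite -signr_odd; case: odd.
    + by rewrite expr0n; case: (q == 0%N).
    by rewrite expr1n.
  by move: E; rewrite x1 yp expr1n => <-.
- move: E; rewrite x2 yp lucasU_id => /power_eq_id[] // [-> ->].
    by right; left.
  by move=> ->; right; right; left.
Qed.

(** * Conjugation *)

(** A number strictly between two consecutive squares is not the square of a
rational. *)
Lemma sqr_between_eq0 (c D v w : int) :
  0 <= c -> c ^+ 2 < D -> D < (c + 1) ^+ 2 -> w ^+ 2 = v ^+ 2 * D -> v = 0.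
Proof.
move=> c0 cD Dc wv; apply/eqP/negPn/negP => v0.
have /dvdzP[t wE] : (v %| w)%Z by rewrite -(@dvdz_pexp2r _ _ 2) // wv dvdz_mulr.
have tD : t ^+ 2 = D.
  by apply: (@mulfI _ (v ^+ 2)); rewrite ?expf_neq0 // -wv wE exprMn mulrC.
rewrite -tD -(real_normK (num_real t)) in cD Dc.
have h : c < `|t| by rewrite -(ltr_pXn2r (n := 2)).
have h' : `|t| < c + 1 by rewrite -(ltr_pXn2r (n := 2)) // nnegrE; lia.
by lia.
Qed.

(** The norm form of Z[al] is anisotropic because its discriminant x^2 - 4 y is not
a square. *)
Lemma quadratic_form_eq0 x y (u v : int) : lucas_range x y ->
  u ^+ 2 + u * v * x + v ^+ 2 * y = 0 -> u = 0 /\ v = 0.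
Proof.
move=> xy E; have v0 : v = 0.
  have h : (2 * u + v * x) ^+ 2 = v ^+ 2 * (x ^+ 2 - 4 * y).
    have -> : (2 * u + v * x) ^+ 2
      = 4 * (u ^+ 2 + u * v * x + v ^+ 2 * y) + v ^+ 2 * (x ^+ 2 - 4 * y) by ring.
    by rewrite E mulr0 add0r.
  by case: xy h => -[-> hx]; [apply: (@sqr_between_eq0 x)|apply: (@sqr_between_eq0 (x - 1))]; nia.
split=> //; apply/eqP; rewrite -sqrf_eq0; apply/eqP.
by move: E; rewrite v0 mulr0 mul0r expr0n mul0r !addr0.
Qed.

Section Conjugation.
Variables (F : numFieldType) (x y : int).
Implicit Types al be z w : F.

Definition root_pair al be := al + be = x%:~R /\ al * be = y%:~R.

(** Conjugation in Z[al], as a relation between real numbers: it saves building the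
quadratic ring, and conjugate_eq0 shows that z determines z'. *)
Definition conjugate al be z z' := exists u v : int,
  z = u%:~R + v%:~R * al /\ z' = u%:~R + v%:~R * be.

Lemma root_pairC al be : root_pair al be -> root_pair be al.
Proof. by rewrite /root_pair addrC mulrC. Qed.

Lemma root_sqr al be : root_pair al be -> al * al = x%:~R * al - y%:~R.
Proof. by move=> [<- <-]; ring. Qed.

Lemma conjugate_int al be m : conjugate al be m%:~R m%:~R.
Proof. by exists m, 0; rewrite !mul0r !addr0. Qed.

Lemma conjugate_nat al be m : conjugate al be m%:R m%:R.
Proof. exact: (conjugate_int _ _ m%:Z). Qed.

Lemma conjugate_root al be : conjugate al be al be.
Proof. by exists 0, 1; rewrite !mul1r !add0r. Qed.

Lemma conjugate_other_root al be : root_pair al be -> conjugate al be be al.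
Proof.
by move=> [s _]; exists x, (-1); rewrite -s rmorphN1; split; ring.
Qed.

Lemma conjugateD al be z z' w w' : conjugate al be z z' ->
  conjugate al be w w' -> conjugate al be (z + w) (z' + w').
Proof.
move=> [u [v [-> ->]]] [u' [v' [-> ->]]]; exists (u + u'), (v + v').
by rewrite !rmorphD /=; split; ring.
Qed.

Lemma conjugateN al be z z' : conjugate al be z z' -> conjugate al be (- z) (- z').
Proof.
move=> [u [v [-> ->]]]; exists (- u), (- v).
by rewrite !rmorphN /=; split; ring.
Qed.

Lemma conjugateB al be z z' w w' : conjugate al be z z' ->
  conjugate al be w w' -> conjugate al be (z - w) (z' - w').
Proof. by move=> h h'; apply: conjugateD => //; apply: conjugateN. Qed.

Lemma conjugateM al be z z' w w' : root_pair al be -> conjugate al be z z' ->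
  conjugate al be w w' -> conjugate al be (z * w) (z' * w').
Proof.
move=> h [u [v [-> ->]]] [u' [v' [-> ->]]].
exists (u * u' - v * v' * y), (u * v' + v * u' + v * v' * x).
have e (a : F) : (u%:~R + v%:~R * a) * (u'%:~R + v'%:~R * a)
  = u%:~R * u'%:~R + (u%:~R * v'%:~R + v%:~R * u'%:~R) * a + v%:~R * v'%:~R * (a * a).
  by ring.
rewrite !e (root_sqr h) (root_sqr (root_pairC h)) !rmorphD rmorphN !rmorphM /=.
by split; ring.
Qed.

Lemma conjugateX al be z z' n : root_pair al be -> conjugate al be z z' ->
  conjugate al be (z ^+ n) (z' ^+ n).
Proof.
move=> h hz; elim: n => [|n IH]; first exact: (conjugate_nat _ _ 1).
by rewrite !exprS; apply: conjugateM.
Qed.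

Lemma conjugate_norm al be z z' : root_pair al be -> conjugate al be z z' ->
  exists m : int, z * z' = m%:~R.
Proof.
move=> [s p] [u [v [-> ->]]]; exists (u ^+ 2 + u * v * x + v ^+ 2 * y).
rewrite !(rmorphD, rmorphM, rmorphXn) /= -s -p; ring.
Qed.

Lemma conjugate_eq0 al be z z' : lucas_range x y -> root_pair al be ->
  conjugate al be z z' -> z = 0 -> z' = 0.
Proof.
move=> xy [s p] [u [v [zE ->]]] z0.
have : (u ^+ 2 + u * v * x + v ^+ 2 * y)%:~R = 0 :> F.
  have -> : (u ^+ 2 + u * v * x + v ^+ 2 * y)%:~R = z * (u%:~R + v%:~R * be).
    by rewrite zE !(rmorphD, rmorphM, rmorphXn) /= -s -p; ring.
  by rewrite z0 mul0r.
move=> /eqP; rewrite intr_eq0 => /eqP /(quadratic_form_eq0 xy)[-> ->].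
by rewrite mul0r addr0.
Qed.

Lemma conjugate_sym al be z z' : conjugate al be z z' -> conjugate be al z' z.
Proof. by move=> [u [v [zE zE']]]; exists u, v. Qed.

Lemma conjugate_norm_ge1 al be z z' : lucas_range x y -> root_pair al be ->
  conjugate al be z z' -> z * z' != 0 -> 1 <= `|z * z'|.
Proof.
move=> xy h hz; have [m ->] := conjugate_norm h hz.
by rewrite intr_eq0 -intr_norm ler1z; lia.
Qed.

(** The cofactor w has an integer norm, so an element z of norm greater than 1 in
absolute value divides no unit. *)
Lemma norm_gt1_ndvd al be z z' w w' e : root_pair al be -> conjugate al be w w' ->
  1 < `|z * z'| -> `|e| = 1 -> (z * w) * (z' * w') = e -> False.
Proof.
move=> h hw zz e1; have [m mE] := conjugate_norm h hw.
rewrite mulrACA mE => E; have := e1; rewrite -E normrM -intr_norm => E1.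
have [m0|m0] : (`|m| = 0) \/ (1 <= `|m|) by lia.
  by move: E1; rewrite m0 mulr0 => /eqP; rewrite eq_sym oner_eq0.
move: m0; rewrite -(ler1z F) => m0.
have : `|z * z'| <= 1 by rewrite -E1 ler_peMr.
by move/(lt_le_trans zz); rewrite ltxx.
Qed.

End Conjugation.

(** * The norm form of the sum equation *)

(** With g = al^p, d = al - be, N = n q, a = p - q and b = q - p (one of them 0),
this is (g - 1)^2 times the difference of the leading terms of the two sides of
d^b (sum_j j (al^j - be^j)^p) = d^a (al^n - be^n)^q, up to the small summand
d^b g. *)
Definition norm_form (F : numFieldType) (p k N a b : nat) (al be : F) : F :=
  (al - be) ^+ b * (al ^+ p) ^+ k.+1 * (k%:R * (al ^+ p - 1) - 1)
  - (al - be) ^+ a * al ^+ N * (al ^+ p - 1) ^+ 2.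

Lemma norm_form_conjugate (F : numFieldType) x y (al be : F) p k N a b :
  root_pair x y al be ->
  conjugate al be (norm_form p k N a b al be) (norm_form p k N a b be al).
Proof.
move=> h; have ha := conjugate_root al be.
have hb := conjugate_other_root h.
have hd := conjugateB ha hb; have hp n := conjugateX n h ha.
have h1 := conjugate_nat al be 1; have hk := conjugate_nat al be k.
have hg := conjugateB (hp p) h1.
apply: conjugateB; apply: (conjugateM h); do ?[exact: conjugateX h _].
- by apply: (conjugateM h); apply: (conjugateX _ h).
- by apply: conjugateB => //; apply: (conjugateM h).
by apply: (conjugateM h); apply: (conjugateX _ h).
Qed.

Lemma expr_near1_gen (F : realFieldType) (c w : F) (p : nat) : 0 < c ->
  `|w| <= c -> `|(1 + w) ^+ p - 1| <= c^-1 * ((1 + c) ^+ p - 1) * `|w|.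
Proof.
move=> c0 hw; elim: p => [|p IH]; first by rewrite !expr0 !subrr normr0 mulr0 mul0r.
have -> : (1 + w) ^+ p.+1 - 1 = (1 + w) * ((1 + w) ^+ p - 1) + w by rewrite exprS; ring.
apply: le_trans (ler_normD _ _) _; rewrite normrM.
have h1 : `|1 + w| <= 1 + c.
  by apply: le_trans (ler_normD _ _) _; rewrite normr1; lra.
apply: le_trans (lerD (ler_pM (normr_ge0 _) (normr_ge0 _) h1 IH) (lexx _)) _.
by rewrite le_eqVlt; apply/orP; left; apply/eqP; rewrite exprS; field; rewrite gt_eqF.
Qed.

(** The constant bounds ((1 + c)^11 - 1) / c at c = 25/144, the square of the bound
5/12 on al^-1. *)
Lemma expr_near1 (F : realFieldType) (w : F) (p : nat) : (p <= 11)%N ->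
  `|w| <= 25 / 144 -> `|(1 + w) ^+ p - 1| <= 28 * `|w|.
Proof.
move=> p11 hw; have c0 : 0 < 25 / 144 :> F by lra.
apply: le_trans (expr_near1_gen p c0 hw) _; apply: ler_wpM2r => //.
have : (1 + 25 / 144 : F) ^+ p <= (1 + 25 / 144) ^+ 11 by apply: ler_weXn2l => //; lra.
by lra.
Qed.

(** The threshold 1/33 exceeds (25/144)^2, so this applies to be^n / al^n for n >= 2. *)
Lemma expr_near1_bounds (F : realFieldType) (w : F) (p : nat) : (p <= 11)%N ->
  `|w| <= 1 / 33 -> 7 / 10 <= (1 + w) ^+ p <= 7 / 5.
Proof.
rewrite ler_norml => p11 /andP[h1 h2]; apply/andP; split.
  apply: (@le_trans _ _ ((32 / 33) ^+ p)).
    by apply: (@le_trans _ _ ((32 / 33) ^+ 11)); [lra|apply: ler_wiXn2l => //; lra].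
  by apply: lerXn2r; rewrite ?nnegrE; lra.
apply: (@le_trans _ _ ((34 / 33) ^+ p)).
  by apply: lerXn2r; rewrite ?nnegrE; lra.
by apply: (@le_trans _ _ ((34 / 33) ^+ 11)); [apply: ler_weXn2l => //; lra|lra].
Qed.

Lemma sum_arith_geom (F : comNzRingType) (g : F) (k : nat) :
  (\sum_(1 <= j < k.+1) j%:R * g ^+ j) * (g - 1) ^+ 2
  = g ^+ k.+1 * (k%:R * (g - 1) - 1) + g.
Proof.
elim: k => [|k IH]; first by rewrite big_geq //; ring.
rewrite big_nat_recr //= mulrDl IH -natr1 (exprS g k.+1); ring.
Qed.

(** From here on be is al^-1 up to sign, al is at least 12/5 and i stands for al^-1. *)
Section Roots.
Variables (F : realFieldType) (x y : int) (al be : F).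
Hypotheses (xy : lucas_range x y) (rp : root_pair x y al be) (al12 : 12 / 5 <= al).

Let i := al^-1.

Lemma al_gt0 : 0 < al. Proof. by move: al12; lra. Qed.

Lemma inv_gt0 : 0 < i. Proof. by rewrite invr_gt0 al_gt0. Qed.

Lemma mul_inv : al * i = 1. Proof. by rewrite mulfV // gt_eqF // al_gt0. Qed.

Lemma inv_le : i <= 5 / 12.
Proof. by rewrite -(ler_pM2l al_gt0) mul_inv; move: al12; lra. Qed.

Lemma exp_inv n : al ^+ n * i ^+ n = 1.
Proof. by rewrite -exprMn mul_inv expr1n. Qed.

Lemma norm_be : `|be| = i.
Proof.
have beE : be = y%:~R * i by case: rp => _ <-; rewrite mulrAC mul_inv mul1r.
rewrite beE normrM (gtr0_norm inv_gt0).
by case: xy => -[-> _]; rewrite ?rmorphN ?normrN normr1 mul1r.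
Qed.

Lemma norm_beX n : `|be ^+ n| = i ^+ n. Proof. by rewrite normrX norm_be. Qed.

Lemma invX_le n : i ^+ n <= 1.
Proof. by apply: exprn_ile1; have := inv_gt0; have := inv_le; lra. Qed.

Lemma invX_gt0 n : 0 < i ^+ n. Proof. by rewrite exprn_gt0 // inv_gt0. Qed.

Lemma alX_gt0 n : 0 < al ^+ n. Proof. by rewrite exprn_gt0 // al_gt0. Qed.

Lemma alX_ge1 n : 1 <= al ^+ n. Proof. by rewrite exprn_ege1 //; move: al12; lra. Qed.

(** Write c = k (g - 1) - 1. If the form vanishes, so does its conjugate. For a = 0
the vanishing gives d^b g^(k+1) c = al^N (g - 1)^2, and since c and g - 1 are
coprime, c divides the unit al^N. For b = 0 it makes g - 1 divide the unit
g^(k+1). Both c and g - 1 (the latter for p >= 2) have norm greater than 1. *)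
Lemma norm_form_neq0 p k N a b : (2 < k)%N -> (0 < p)%N ->
  a = 0%N \/ b = 0%N /\ (1 < p)%N ->
  norm_form p k N a b al be * norm_form p k N a b be al != 0.
Proof.
move=> k3 p0 ab; apply/negP => /eqP; set z := norm_form _ _ _ _ _ _ _.
set z' := norm_form _ _ _ _ _ _ _ => zz'.
have hz : conjugate al be z z' by apply: norm_form_conjugate rp.
have [z0 z'0] : z = 0 /\ z' = 0.
  move/eqP: zz'; rewrite mulf_eq0 => /orP[] /eqP h; split=> //.
    exact: (conjugate_eq0 xy rp hz h).
  exact: (conjugate_eq0 xy (root_pairC rp) (conjugate_sym hz) h).
move: z0 z'0; rewrite /z /z' /norm_form => {zz' hz z z'}.
have ha := conjugate_root al be.
have hb := conjugate_other_root rp.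
have hd := conjugateB ha hb; have hp n := conjugateX n rp ha.
have h1 := conjugate_nat al be 1; have hk := conjugate_nat al be k.
have hg := conjugateB (hp p) h1.
have e1 n : `|al ^+ n * be ^+ n| = 1.
  by rewrite normrM normrX norm_beX gtr0_norm ?al_gt0 // exp_inv.
have k3R : 3 <= k%:R :> F by rewrite ler_nat.
have ga_ge : 12 / 5 <= al ^+ p.
  by apply: le_trans al12 _; rewrite -{1}(expr1 al) ler_weXn2l //; move: al12; lra.
have gb_le : `|be ^+ p| <= 5 / 12.
  rewrite norm_beX; apply: le_trans inv_le; rewrite -{2}(expr1 i).
  by apply: ler_wiXn2l => //; [apply/ltW/inv_gt0|have := inv_le; lra].
case: ab => [a0|[b0 p1]]; rewrite ?a0 ?b0 !expr0 ?mul1r => z0 z'0.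
  set c := (k%:R * (al ^+ p - 1) - 1) in z0.
  set c' := (k%:R * (be ^+ p - 1) - 1) in z'0.
  pose w (u v : F) := k%:R ^+ 2 * (u - v) ^+ b * (u ^+ p) ^+ k.+1
            - u ^+ N * (k%:R * (u ^+ p - 1) + 1).
  have hw : conjugate al be (w al be) (w be al).
    apply: conjugateB; apply: (conjugateM rp) => //.
    - by apply: (conjugateM rp); apply: (conjugateX _ rp).
    - by do 2 apply: (conjugateX _ rp).
    by apply: conjugateD => //; apply: (conjugateM rp).
  apply: (@norm_gt1_ndvd F x y al be c c' _ _ (al ^+ N * be ^+ N) rp hw _ (e1 N)).
    rewrite normrM.
    have c1 : 3 <= `|c|.
      by apply: le_trans (ler_norm _); rewrite /c; nra.
    have c2 : 5 / 2 <= `|c'|.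
      rewrite -normrN; apply: le_trans (ler_norm _); rewrite /c'.
      by move: gb_le; rewrite ler_norml => /andP[]; nra.
    by apply: (@lt_le_trans _ _ (3 * (5 / 2))); [lra|apply: ler_pM; lra].
  (* 1 = (K g)^2 - (K g - 1) (K g + 1), where g^2 is a multiple of K g - 1. *)
  have gen (D G A g K : F) : D * G * (K * g - 1) - A * g ^+ 2 = 0 ->
      (K * g - 1) * (K ^+ 2 * D * G - A * (K * g + 1)) = A.
    move=> E; rewrite -[RHS]addr0 -(mulr0 (K ^+ 2)) -E; ring.
  by congr (_ * _); apply: gen.
pose w (u v : F) := k%:R * (u ^+ p) ^+ k.+1 - (u - v) ^+ a * u ^+ N * (u ^+ p - 1).
have hw : conjugate al be (w al be) (w be al).
  apply: conjugateB; apply: (conjugateM rp) => //.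
  - by do 2 apply: (conjugateX _ rp).
  by apply: (conjugateM rp); apply: (conjugateX _ rp).
apply: (@norm_gt1_ndvd F x y al be (al ^+ p - 1) (be ^+ p - 1) _ _
   (al ^+ (p * k.+1) * be ^+ (p * k.+1)) rp hw _ (e1 _)).
  rewrite normrM.
  have c1 : 19 / 4 <= `|al ^+ p - 1|.
    apply: le_trans (ler_norm _); have : al ^+ 2 <= al ^+ p by rewrite ler_weXn2l //; move: al12; lra.
    by move: al12; nra.
  have c2 : 7 / 12 <= `|be ^+ p - 1|.
    rewrite -normrN; apply: le_trans (ler_norm _).
    by move: gb_le; rewrite ler_norml => /andP[]; lra.
  by apply: (@lt_le_trans _ _ (19 / 4 * (7 / 12))); [lra|apply: ler_pM; lra].
have gen (D G A g K : F) : G * (K * g - 1) - D * A * g ^+ 2 = 0 ->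
    g * (K * G - D * A * g) = G.
  by move=> E; rewrite -[RHS]addr0 -E; ring.
by rewrite !exprM; congr (_ * _); apply: gen.
Qed.

End Roots.

(** * Solving the growth comparison for k *)

(** The three possible shapes of the comparison
X A (k (1 - g) - g) ~ Y C (1 - g)^2 with relative error e / k, where now
g = al^-p, the factors X and Y are close to 1, and C / A is a power of al: here
C / A <= 1 is too small for k >= 3. *)
Lemma window_small (F : realFieldType) (X Y A C kap e h : F) :
  0 < A -> 0 <= C -> C <= A -> 97 / 100 <= X -> 0 <= Y -> Y <= 103 / 100 ->
  0 <= h -> h <= 1 -> 5 / 2 <= kap - e ->
  `|X * A * kap - Y * C * h| <= X * A * e -> False.
Proof.
move=> A0 C0 CA X1 Y0 Y2 h0 h1 ke; rewrite ler_norml => /andP[_ W].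
have YC : Y * C * h <= 103 / 100 * A.
  rewrite -[leRHS]mulr1; apply: ler_pM => //; first by rewrite mulr_ge0.
  exact: ler_pM.
have XK : 97 / 100 * (5 / 2) <= X * (kap - e) by apply: ler_pM => //; lra.
have : A * (97 / 100 * (5 / 2)) <= A * (X * (kap - e)) by rewrite ler_pM2l.
have -> : A * (X * (kap - e)) = X * A * kap - X * A * e by ring.
by lra.
Qed.

(** Here C / A >= al^2 >= 396 is too large for k <= 241. *)
Lemma window_large (F : realFieldType) (X Y A C kap e h : F) :
  0 < A -> 396 * A <= C -> 0 <= X -> X <= 103 / 100 -> 97 / 100 <= Y ->
  9 / 10 <= h -> 0 <= kap + e -> kap + e <= 243 ->
  `|X * A * kap - Y * C * h| <= X * A * e -> False.
Proof.
move=> A0 CA X0 X2 Y1 h1 ke0 ke; rewrite ler_norml => /andP[W _].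
have YC : 97 / 100 * (396 * A) * (9 / 10) <= Y * C * h.
  by apply: ler_pM; [lra|lra|apply: ler_pM; lra|].
have XK : X * (kap + e) <= 103 / 100 * 243 by apply: ler_pM.
have : A * (X * (kap + e)) <= A * (103 / 100 * 243) by rewrite ler_pM2l.
have -> : A * (X * (kap + e)) = X * A * kap + X * A * e by ring.
by lra.
Qed.

(** The remaining case C = al A pins k down to a neighbourhood of al, or of al - 1
when p = 1, of radius less than 1. *)
Section Equal.
Variables (F : realFieldType) (X Y al i k e g : F).
Hypotheses (ali : al * i = 1) (i0 : 0 < i) (i_le : i <= 10 / 199).
Hypotheses (k3 : 3 <= k) (g0 : 0 < g) (gi : g <= i).
Let kap := k * (1 - g) - g.
Hypothesis W : `|X * kap - Y * al * (1 - g) ^+ 2| <= X * e.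

Let al0 : 0 < al.
Proof. by rewrite -(pmulr_lgt0 _ i0) ali. Qed.

Let h01 : 0 <= (1 - g) ^+ 2 <= 1.
Proof.
rewrite sqr_ge0 /=.
have h : 0 <= 1 - g <= 1 by apply/andP; split; move: gi i_le g0; lra.
by case/andP: h => h1 h2; rewrite expr2 -[leRHS]mulr1; apply: ler_pM.
Qed.

Let kap_le : kap <= k.
Proof.
have h : 0 <= k * g by rewrite mulr_ge0 ?ltW //; move: k3; lra.
by rewrite /kap; move: h g0; lra.
Qed.

Let kap_ge : 949 / 1000 * k - 51 / 1000 <= kap.
Proof.
have h : k * g <= k * (10 / 199).
  by rewrite ler_wpM2l //; [move: k3; lra|move: gi i_le; lra].
by rewrite /kap; move: h gi i_le k3; lra.
Qed.

Let kap0 : 0 <= kap. Proof. by move: kap_ge k3; lra. Qed.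

Lemma window_index_le : 97 / 100 <= X -> Y <= 103 / 100 ->
  e <= 1 / 1000 * k + 34 / 1000 -> k <= 113 / 100 * al + 1 / 8.
Proof.
move=> X1 Y2 e_le.
have ke : 0 <= kap - e by move: kap_ge k3 e_le; lra.
have XK : 97 / 100 * (kap - e) <= X * (kap - e) by rewrite ler_wpM2r.
have YA : Y * al * (1 - g) ^+ 2 <= 103 / 100 * al.
  case/andP: h01 => h0 h1.
  apply: (@le_trans _ _ (103 / 100 * al * (1 - g) ^+ 2)).
    by rewrite ler_wpM2r // ler_pM2r.
  by apply: ler_piMr => //; move: al0; lra.
have : X * (kap - e) <= 103 / 100 * al.
  by move: W YA; rewrite ler_norml => /andP[_]; lra.
by move: XK kap_ge e_le al0; lra.
Qed.

Lemma window_center : X = 1 \/ Y = 1 ->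
  `|X - 1| <= 52 / 5 * i ^+ 2 -> `|Y - 1| <= 52 / 5 * i ^+ 2 ->
  0 <= e -> e <= 1 / 20 -> k <= 113 / 100 * al + 1 / 8 ->
  `|kap - al * (1 - g) ^+ 2| <= 66 / 100.
Proof.
move=> XY hX hY e0 e_le kal; have := W; set h := (1 - g) ^+ 2 => W0.
have ai : al * i ^+ 2 = i by rewrite expr2 mulrA ali mul1r.
have i2 : i ^+ 2 <= 10 / 199 * (10 / 199) by rewrite expr2; apply: ler_pM => //; apply: ltW.
case: XY => E.
  have -> : kap - al * h = (X * kap - Y * al * h) + (Y - 1) * (al * h) by rewrite E; ring.
  apply: le_trans (ler_normD _ _) _; rewrite [X in _ + X]normrM.
  have h1 : `|al * h| <= al.
    case/andP: h01 => h0 h1; rewrite normrM gtr0_norm // ger0_norm //.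
    by apply: ler_piMr => //; apply: ltW.
  have h2 : `|Y - 1| * `|al * h| <= 52 / 5 * i ^+ 2 * al by apply: ler_pM.
  have h3 : 52 / 5 * i ^+ 2 * al = 52 / 5 * i by rewrite -mulrA (mulrC (i ^+ 2)) ai.
  by move: W0 h2; rewrite E h3 mul1r; move: e_le i_le; lra.
have -> : kap - al * h = (X * kap - Y * al * h) - (X - 1) * kap by rewrite E; ring.
apply: le_trans (ler_normB _ _) _; rewrite [X in _ + X]normrM (ger0_norm kap0).
have h2 : `|X - 1| * kap <= 52 / 5 * i ^+ 2 * (113 / 100 * al + 1 / 8).
  by apply: ler_pM => //; apply: le_trans kap_le kal.
have h3 : X * e <= 103 / 100 * (1 / 20).
  apply: ler_pM => //; move: hX i2; rewrite ler_norml => /andP[]; lra.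
have h4 : 52 / 5 * i ^+ 2 * (113 / 100 * al + 1 / 8)
  = 52 / 5 * (113 / 100 * i) + 52 / 40 * i ^+ 2.
  by rewrite -[X in _ * (_ * X) + _]ai; field.
by move: W0 h2 h3; rewrite h4; move: i2 i_le; lra.
Qed.

(** The case p = 1, where al (1 - i)^2 = al - 2 + i. *)
Lemma window_index1 : g = i -> `|kap - al * (1 - g) ^+ 2| <= 66 / 100 ->
  `|k - al + 1| <= 9 / 10.
Proof.
move=> gE; have -> : kap - al * (1 - g) ^+ 2 = (k - al + 1) * (1 - i) - i.
  rewrite /kap gE.
  have -> : (k - al + 1) * (1 - i) - i = k * (1 - i) - i - al + 1 * (1 - i) + al * i by ring.
  have -> : al * (1 - i) ^+ 2 = al - 2 * (al * i) + (al * i) * i by ring.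
  by rewrite ali; ring.
rewrite !ler_norml; move: (k - al + 1) => z /andP[z1 z2].
by apply/andP; split; move: z1 z2 i0 i_le; nra.
Qed.

(** The case p >= 2, where g is at most i^2. *)
Lemma window_index2 : g <= i ^+ 2 -> k <= 113 / 100 * al + 1 / 8 ->
  `|kap - al * (1 - g) ^+ 2| <= 66 / 100 -> `|k - al| <= 9 / 10.
Proof.
move=> gE kal; have ai : al * i ^+ 2 = i by rewrite expr2 mulrA ali mul1r.
have i2 : i ^+ 2 <= 10 / 199 * (10 / 199) by rewrite expr2; apply: ler_pM => //; apply: ltW.
have h1 : al * g <= i by rewrite -ai ler_pM2l.
have h1' : 0 <= al * g by rewrite mulr_ge0 // ltW.
have h2 : k * g <= 113 / 100 * i + 1 / 8 * i ^+ 2.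
  have -> : 113 / 100 * i + 1 / 8 * i ^+ 2 = (113 / 100 * al + 1 / 8) * i ^+ 2.
    by rewrite -[X in _ * X + _ = _]ai; field.
  by apply: ler_pM => //; [move: k3; lra|apply: ltW].
have h2' : 0 <= k * g by rewrite mulr_ge0 ?ltW //; move: k3; lra.
have h3 : al * g * g <= i * (10 / 199) by apply: ler_pM => //; [exact: ltW|move: gi i_le; lra].
have h3' : 0 <= al * g * g by rewrite mulr_ge0 // ltW.
have -> : kap - al * (1 - g) ^+ 2 = (k - al) - k * g - g + 2 * (al * g) - al * g * g.
  by rewrite /kap; ring.
rewrite !ler_norml => /andP[z1 z2]; apply/andP.
have gen (u kg ag agg j : F) : - (66 / 100) <= u - kg - g + 2 * ag - agg ->
    u - kg - g + 2 * ag - agg <= 66 / 100 -> 0 <= kg -> 0 <= ag -> ag <= i -> 0 <= agg ->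
    agg <= i * (10 / 199) -> kg <= 113 / 100 * i + 1 / 8 * j -> j <= 10 / 199 * (10 / 199) ->
    - (9 / 10) <= u /\ u <= 9 / 10.
  by move=> *; split; move: i_le gi g0; lra.
exact: (gen _ _ _ _ _ z1 z2 h2' h1' h1 h3' h3 h2 i2).
Qed.

End Equal.

(** * Bounding the index k *)

(** Five dyadic ranges of k; in the last one j is bounded linearly in k, which
is all that is needed there. *)
Lemma log2_upper (k : nat) : exists2 j, (k < 2 ^ j)%N &
  (j = 5)%N \/ (j = 6 /\ 32 <= k)%N \/ (j = 7 /\ 64 <= k)%N
  \/ (j = 8 /\ 128 <= k)%N \/ (9 <= j /\ 128 * (j - 7) <= k)%N.
Proof.
have [h|h5] := ltnP k (2 ^ 5); first by exists 5%N; auto.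
have [h|h6] := ltnP k (2 ^ 6); first by exists 6%N; auto.
have [h|h7] := ltnP k (2 ^ 7); first by exists 7%N; auto.
have [h|h8] := ltnP k (2 ^ 8); first by exists 8%N => //; do 3 right; left.
exists (trunc_log 2 k).+1; first by rewrite trunc_log_ltn.
do 4 right; have k0 : (0 < k)%N by apply: leq_trans h5.
have h := trunc_logP (isT : (1 < 2)%N) k0.
have t8 : (8 <= trunc_log 2 k)%N by rewrite trunc_log_max.
split=> //; apply: leq_trans h; rewrite -(subnK t8).
elim: (_ - 8)%N => [|i IH] //; rewrite addSn expnS; move: IH.
by move: (2 ^ _)%N => u; lia.
Qed.

(** The alternatives say that 2 n, or min(p, 2) k, is at most
max(2 b + p, 2 a + 2 p) plus O(log k), and n grows at least like k p / q.
Once p, q and the dyadic range of k are known, this is linear. *)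
Lemma index_bound_nat (p q k n : nat) : (0 < p)%N -> (0 < q)%N ->
  (p <= 11)%N -> (q <= 11)%N -> (k * p + q <= n * q + p + 1)%N ->
  (forall j, (k < 2 ^ j)%N ->
    (5 * (2 * n) < 5 * maxn (2 * (q - p) + p) (2 * (p - q) + 2 * p) + 4 * (14 + 2 * j))%N \/
    (5 * (minn p 2 * k) < 5 * maxn (2 * (q - p) + p) (2 * (p - q) + 2 * p) + 4 * (12 + 3 * j))%N) ->
  (k <= 240 %/ p + p)%N.
Proof.
move=> p0 q0 p11 q11 nk h; have [j kj hj] := log2_upper k.
have {h}hn := h j kj; have {}kj : (j = 5 -> k < 32)%N /\ (j = 6 -> k < 64)%N /\ (j = 7 -> k < 128)%N.
  by do !split; move=> E; move: kj; rewrite E.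
have pc : (p = 1 \/ p = 2 \/ p = 3 \/ p = 4 \/ p = 5 \/ p = 6 \/ p = 7 \/ p = 8 \/
  p = 9 \/ p = 10 \/ p = 11)%N by move: p0 p11; clear; lia.
have qc : (q = 1 \/ q = 2 \/ q = 3 \/ q = 4 \/ q = 5 \/ q = 6 \/ q = 7 \/ q = 8 \/
  q = 9 \/ q = 10 \/ q = 11)%N by move: q0 q11; clear; lia.
clear p0 p11 q0 q11.
repeat (destruct pc as [pc|pc]); subst p;
  repeat (destruct qc as [qc|qc]); subst q.
all: lia.
Qed.

(** Takes base-2 logarithms of the hypothesis with al^4 >= 2^5. *)
Lemma log_compare (F : realFieldType) (al : F) (M E c s k j : nat) :
  12 / 5 <= al -> (0 < s)%N -> (k < 2 ^ j)%N ->
  al ^+ M <= 2 ^+ c * k%:R ^+ s * al ^+ E -> (5 * M < 5 * E + 4 * (c + s * j))%N.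
Proof.
move=> al12 s0 kj h; rewrite ltnNge; apply/negP => hM.
have EM : (E <= M)%N by lia.
have al0 : 0 < al by lra.
have h1 : al ^+ (M - E) <= 2 ^+ c * k%:R ^+ s.
  by rewrite -(ler_pM2r (exprn_gt0 E al0)) -exprD subnK.
have h2 : 2 ^+ c * k%:R ^+ s < 2 ^+ (c + s * j) :> F.
  rewrite exprD (mulnC s) exprM ltr_pM2l ?exprn_gt0 //.
  by rewrite ltrXn2r ?nnegrE -?lt0n // -natrX ltr_nat.
have h3 : (al ^+ (M - E)) ^+ 4 < (2 ^+ (c + s * j)) ^+ 4.
  rewrite ltr_pXn2r ?nnegrE ?exprn_ge0 ?(ltW al0) //.
  exact: le_lt_trans h1 h2.
have a4 : 2 ^+ 5 <= al ^+ 4.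
  have a2 : 144 / 25 <= al ^+ 2 by nra.
  by rewrite (exprD al 2 2); nra.
have : (2 ^+ 5) ^+ (M - E) <= (al ^+ 4) ^+ (M - E).
  by apply: lerXn2r; rewrite ?nnegrE ?exprn_ge0 ?(ltW al0).
move: h3; rewrite -!exprM (mulnC 4) => h3 h4.
have := le_lt_trans h4 h3; rewrite ltr_eXn2l ?ltr1n //.
by move: hM EM; clear; lia.
Qed.

(** * Size estimates *)

Definition power_sum (x y : int) (p k : nat) : int :=
  \sum_(1 <= j < k.+1) j%:Z * lucasU x y j ^+ p.

Lemma power_sumS x y p k :
  power_sum x y p k.+1 = power_sum x y p k + k.+1%:Z * lucasU x y k.+1 ^+ p.
Proof. by rewrite /power_sum big_nat_recr. Qed.

Lemma power_sum_ge x y p k : lucas_range x y ->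
  0 <= power_sum x y p k /\ ((0 < k)%N -> k%:Z * lucasU x y k ^+ p <= power_sum x y p k).
Proof.
move=> xy; elim: k => [|k [IH _]]; first by rewrite /power_sum big_geq.
have h : 0 <= k.+1%:Z * lucasU x y k.+1 ^+ p.
  by rewrite mulr_ge0 // exprn_ge0 // ltW // lucasU_gt0.
rewrite power_sumS; move: IH h; set A := power_sum _ _ _ _; set B := _ * _ => IH h.
by split=> [|_]; lia.
Qed.

(** The terms at least double, so the last one is at least half of the sum. *)
Lemma power_sum_le x y p k : lucas_range x y -> (0 < p)%N ->
  power_sum x y p k <= 2 * (k%:Z * lucasU x y k ^+ p).
Proof.
move=> xy p0; elim: k => [|k IH]; first by rewrite /power_sum big_geq // mul0r mulr0.
rewrite power_sumS; have [h0 h] := lucasU_growth k xy.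
have hp : 2 * lucasU x y k ^+ p <= lucasU x y k.+1 ^+ p.
  have h1 : (2 * lucasU x y k) ^+ p <= lucasU x y k.+1 ^+ p.
    by apply: lerXn2r; rewrite ?nnegrE //; lia.
  apply: le_trans h1; rewrite exprMn; apply: ler_wpM2r; first exact: exprn_ge0.
  by rewrite -{1}(expr1 2) ler_weXn2l.
have h0p : 0 <= lucasU x y k ^+ p by rewrite exprn_ge0.
by move: IH hp h0p; set u := lucasU x y k ^+ p; set v := lucasU x y k.+1 ^+ p; nia.
Qed.

Lemma binet (R : comNzRingType) (x y : int) (al be : R) n :
  al + be = x%:~R -> al * be = y%:~R ->
  al ^+ n - be ^+ n = (al - be) * (lucasU x y n)%:~R.
Proof.
move=> s p; elim/ltn_ind: n => -[|[|n]] IH.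
- by rewrite !expr0 subrr mulr0.
- by rewrite !expr1 mulr1.
rewrite lucasUSS rmorphB !rmorphM /= -s -p.
have -> (X u v : R) : X * ((al + be) * u - al * be * v)
  = (al + be) * (X * u) - al * be * (X * v) by ring.
by rewrite -(IH n.+1) // -(IH n) // !exprS; ring.
Qed.

(** P and Q are the leading terms of the two sides of scaled_eq; eps1 and eps2
measure the relative errors made in replacing al^j - be^j by al^j there. *)
Section Estimates.
Variables (F : realFieldType) (x y : int) (al be : F).
Hypotheses (xy : lucas_range x y) (rp : root_pair x y al be) (al12 : 12 / 5 <= al).
Variables (p q k n : nat).
Hypotheses (p0 : (0 < p)%N) (q0 : (0 < q)%N) (p11 : (p <= 11)%N) (q11 : (q <= 11)%N).
Hypotheses (k3 : (2 < k)%N) (n2 : (1 < n)%N).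
Hypothesis eqS : power_sum x y p k = lucasU x y n ^+ q.

Let i := al^-1.
Let d := al - be.
Let a := (p - q)%N.
Let b := (q - p)%N.
Let m := minn p 2.
Let ga := al ^+ p.
Let rho := 1 - be * i.
Let N := (n * q)%N.

Let al0 : 0 < al := al_gt0 al12.
Let i0 : 0 < i := inv_gt0 al12.
Let ali : al * i = 1 := mul_inv al12.
Let i_le : i <= 5 / 12 := inv_le al12.
Let iX_gt0 j : 0 < i ^+ j := invX_gt0 al12 j.
Let iX_le j : i ^+ j <= 1 := invX_le al12 j.
Let aX_gt0 j : 0 < al ^+ j := alX_gt0 al12 j.
Let aX_ge1 j : 1 <= al ^+ j := alX_ge1 al12 j.
Let alXi j : al ^+ j * i ^+ j = 1 := exp_inv al12 j.

Lemma norm_ratio : `|be * i| = i ^+ 2.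
Proof. by rewrite normrM (norm_be xy rp al12) gtr0_norm // expr2. Qed.

Lemma ratio_le j : (0 < j)%N -> i ^+ (2 * j) <= 25 / 144.
Proof.
move=> j0; apply: (@le_trans _ _ (i ^+ 2)).
  by apply: ler_wiXn2l; [apply: ltW|apply: (iX_le 1)|lia].
by have := i_le; have := i0; nra.
Qed.

Lemma diffE : d = al * rho.
Proof. by rewrite /d /rho mulrBr mulr1 mulrCA ali mulr1. Qed.

Lemma rho_bounds : 119 / 144 <= rho <= 169 / 144.
Proof.
have h : `|be * i| <= 25 / 144 by rewrite norm_ratio (@ratio_le 1).
by move: h; rewrite ler_norml /rho => /andP[h1 h2]; apply/andP; split; lra.
Qed.

Lemma d_gt0 : 0 < d.
Proof. by rewrite diffE mulr_gt0 //; have := rho_bounds; lra. Qed.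

Let V j := al ^+ j - be ^+ j.

Lemma V_near j : V j = al ^+ j * (1 - (be * i) ^+ j).
Proof. by rewrite /V exprMn mulrBr mulr1 mulrCA alXi mulr1. Qed.

Lemma norm_ratioX j : `|- (be * i) ^+ j| = i ^+ (2 * j).
Proof. by rewrite normrN normrX norm_ratio -exprM. Qed.

Lemma V_pow_error j r : (r <= 11)%N -> (0 < j)%N ->
  `|V j ^+ r - al ^+ (j * r)| <= 28 * (al ^+ (j * r) * i ^+ (2 * j)).
Proof.
move=> r11 j0; rewrite V_near exprMn -exprM.
have -> (A B : F) : A * B - A = A * (B - 1) by ring.
rewrite normrM (gtr0_norm (aX_gt0 _)) mulrCA; apply: ler_wpM2l; first exact: ltW.
by rewrite -norm_ratioX; apply: expr_near1; rewrite // norm_ratioX ratio_le.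
Qed.

Lemma V_pow_bounds j r : (r <= 11)%N -> (1 < j)%N ->
  7 / 10 * al ^+ (j * r) <= V j ^+ r <= 7 / 5 * al ^+ (j * r).
Proof.
move=> r11 j1; rewrite V_near exprMn -exprM.
have h : `|- (be * i) ^+ j| <= 1 / 33.
  rewrite norm_ratioX; apply: (@le_trans _ _ (i ^+ 4)).
    by apply: ler_wiXn2l; [apply: ltW|apply: (iX_le 1)|lia].
  have h2 := @ratio_le 1 isT; rewrite muln1 in h2.
  have -> : i ^+ 4 = i ^+ 2 * i ^+ 2 by rewrite -exprD.
  by have := iX_gt0 2; nra.
have /andP[h1 h2] := expr_near1_bounds r11 h.
by rewrite ![_ * al ^+ _]mulrC !ler_pM2l // h1.
Qed.

Lemma aXi_le j : (0 < j)%N -> (j <= k)%N ->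
  al ^+ (j * p) * i ^+ (2 * j) <= al ^+ (k * p) * i ^+ (m * k).
Proof.
move=> j1 jk; rewrite /m.
have [p2|p1] := leqP 2 p.
  have e r : al ^+ (r * p) * i ^+ (2 * r) = al ^+ (r * (p - 2)).
    rewrite -{1}(subnK p2) mulnDr exprD -mulrA (mulnC 2 r).
    by rewrite alXi mulr1.
  rewrite !e ler_weXn2l //; first by move: al12; lra.
  by rewrite leq_mul2r jk orbT.
have -> : p = 1%N by lia.
rewrite !muln1 mul1n alXi.
have e : al * i ^+ 2 = i by rewrite expr2 mulrA ali mul1r.
have -> : al ^+ j * i ^+ (2 * j) = i ^+ j by rewrite exprM -exprMn e.
exact: iX_le.
Qed.

Lemma scaled_sum : d ^+ p * (power_sum x y p k)%:~R = \sum_(1 <= j < k.+1) j%:R * V j ^+ p.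
Proof.
rewrite /power_sum rmorph_sum mulr_sumr; apply: eq_bigr => j _.
rewrite rmorphM rmorphXn /= /V (binet j rp.1 rp.2) exprMn; ring.
Qed.

Lemma scaled_eq :
  d ^+ b * (\sum_(1 <= j < k.+1) j%:R * V j ^+ p) = d ^+ a * V n ^+ q.
Proof.
rewrite -scaled_sum eqS mulrA -exprD /V (binet n rp.1 rp.2) exprMn mulrA -exprD.
by rewrite rmorphXn /=; congr (_ ^+ _ * _); rewrite /a /b; lia.
Qed.

Let P := d ^+ b * (k%:R * al ^+ (k * p)).
Let Q := d ^+ a * al ^+ N.

Let dX_gt0 j : 0 < d ^+ j. Proof. by rewrite exprn_gt0 // d_gt0. Qed.

Let k3R : 3 <= k%:R :> F. Proof. by rewrite ler_nat. Qed.

Lemma P_gt0 : 0 < P.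
Proof. by rewrite !mulr_gt0 //; have := k3R; lra. Qed.

(** With Q_le_P: both sides of scaled_eq are within constant factors of their
leading terms. *)
Lemma P_le_Q : P <= 2 * Q.
Proof.
have [_ /(_ (ltnW (ltnW k3))) h] := power_sum_ge p k xy.
have h1 : k%:R * V k ^+ p <= \sum_(1 <= j < k.+1) j%:R * V j ^+ p.
  rewrite -scaled_sum /V (binet k rp.1 rp.2) exprMn mulrCA ler_pM2l //.
  by rewrite -(ler_int F) rmorphM rmorphXn in h.
have /andP[h2 _] := V_pow_bounds p11 (ltnW k3).
have /andP[_ h3] := V_pow_bounds q11 n2.
have h4 : k%:R * (7 / 10 * al ^+ (k * p)) <= k%:R * V k ^+ p by rewrite ler_wpM2l.
have h5 : d ^+ b * (k%:R * (7 / 10 * al ^+ (k * p))) <= d ^+ a * V n ^+ q.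
  by rewrite -scaled_eq (ler_pM2l (dX_gt0 _)); apply: le_trans h1.
have h6 : d ^+ a * V n ^+ q <= d ^+ a * (7 / 5 * al ^+ N) by rewrite (ler_pM2l (dX_gt0 _)).
rewrite /P /Q; move: h5 h6; set A := d ^+ a * V _ ^+ _.
set B := d ^+ b; set C := al ^+ _; set D := d ^+ a; set E := al ^+ _; set K := k%:R.
have -> : B * (K * (7 / 10 * C)) = 7 / 10 * (B * (K * C)) by ring.
have -> : D * (7 / 5 * E) = 7 / 5 * (D * E) by ring.
by lra.
Qed.

Lemma Q_le_P : Q <= 4 * P.
Proof.
have h := power_sum_le k xy p0.
have h1 : \sum_(1 <= j < k.+1) j%:R * V j ^+ p <= 2 * (k%:R * V k ^+ p).
  rewrite -scaled_sum /V (binet k rp.1 rp.2) exprMn.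
  have -> (A B C D : F) : A * (B * (C * D)) = C * (A * (B * D)) by ring.
  by rewrite ler_pM2l //; move: h; rewrite -(ler_int F) !rmorphM rmorphXn.
have /andP[_ h2] := V_pow_bounds p11 (ltnW k3).
have /andP[h3 _] := V_pow_bounds q11 n2.
have h4 : k%:R * V k ^+ p <= k%:R * (7 / 5 * al ^+ (k * p)) by rewrite ler_wpM2l.
have h5 : d ^+ a * V n ^+ q <= d ^+ b * (2 * (k%:R * (7 / 5 * al ^+ (k * p)))).
  by rewrite -scaled_eq (ler_pM2l (dX_gt0 _)); apply: le_trans h1 _; rewrite ler_pM2l.
have h6 : d ^+ a * (7 / 10 * al ^+ N) <= d ^+ a * V n ^+ q by rewrite (ler_pM2l (dX_gt0 _)).
rewrite /P /Q; move: h5 h6; set A := d ^+ a * V _ ^+ _.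
set B := d ^+ b; set C := al ^+ _; set D := d ^+ a; set E := al ^+ _; set K := k%:R.
have -> : B * (2 * (K * (7 / 5 * C))) = 14 / 5 * (B * (K * C)) by ring.
have -> : D * (7 / 10 * E) = 7 / 10 * (D * E) by ring.
by lra.
Qed.

Let eps1 := i ^+ (2 * n).
Let eps2 := i ^+ (m * k).

Lemma sum_error :
  `|\sum_(1 <= j < k.+1) j%:R * V j ^+ p - \sum_(1 <= j < k.+1) j%:R * ga ^+ j|
  <= 28 * (k%:R ^+ 2 * (al ^+ (k * p) * eps2)).
Proof.
rewrite -sumrB; apply: le_trans (ler_norm_sum _ _ _) _.
apply: (@le_trans _ _ (\sum_(1 <= j < k.+1) (28 * (k%:R * (al ^+ (k * p) * eps2))))).
  rewrite big_nat_cond [leRHS]big_nat_cond; apply: ler_sum => j /andP[/andP[j1 jk] _].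
  rewrite -mulrBr normrM normr_nat mulrCA.
  apply: ler_pM => //; first by rewrite ler_nat.
  rewrite /ga -exprM (mulnC p); apply: le_trans (V_pow_error p11 j1) _.
  by rewrite ler_pM2l // aXi_le.
rewrite big_const_nat subn1 /= iter_addr_0 -mulr_natr.
by rewrite le_eqVlt; apply/orP; left; apply/eqP; ring.
Qed.

(** The form is the sum of three contributions: the errors on the two sides, and
the term d^b g left over by the closed form of sum_j j g^j. *)
Lemma form_bound : `|norm_form p k N a b al be|
  <= ga ^+ 2 * (P * (112 * eps1 + 29 * (k%:R * eps2))).
Proof.
set S1 := \sum_(1 <= j < k.+1) j%:R * V j ^+ p.
set S2 := \sum_(1 <= j < k.+1) j%:R * ga ^+ j.
have E2 := V_pow_error q11 (ltnW n2); rewrite -/N -/eps1 in E2.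
have E1 := sum_error; rewrite -/S1 -/S2 in E1.
have -> : norm_form p k N a b al be
    = (ga - 1) ^+ 2 * (d ^+ a * (V n ^+ q - al ^+ N) - d ^+ b * (S1 - S2)) - d ^+ b * ga.
  rewrite /norm_form -/d -/ga.
  have := sum_arith_geom ga k; rewrite -/S2 => h2; have h1 := scaled_eq; rewrite -/S1 in h1.
  have -> : d ^+ b * ga ^+ k.+1 * (k%:R * (ga - 1) - 1)
     = d ^+ b * (S2 * (ga - 1) ^+ 2 - ga) by rewrite h2; ring.
  have -> (A B C : F) : A * (d ^+ a * (B - C) - d ^+ b * (S1 - S2))
     = A * (d ^+ a * B - d ^+ b * S1) - A * (d ^+ a * C - d ^+ b * S2) by ring.
  by rewrite h1; ring.
have g1 : 1 <= ga := aX_ge1 p.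
apply: le_trans (ler_normB _ _) _; rewrite normrM.
have n1 : `|(ga - 1) ^+ 2| <= ga ^+ 2.
  have n0 : `|ga - 1| <= ga by rewrite ger0_norm; lra.
  by rewrite normrX; apply: lerXn2r; rewrite ?nnegrE //; lra.
have n2' : `|d ^+ a * (V n ^+ q - al ^+ N) - d ^+ b * (S1 - S2)|
   <= 28 * (Q * eps1) + 28 * (P * (k%:R * eps2)).
  apply: le_trans (ler_normB _ _) _; apply: lerD.
    rewrite normrM (gtr0_norm (dX_gt0 _)).
    have -> : 28 * (Q * eps1) = d ^+ a * (28 * (al ^+ N * eps1)) by rewrite /Q; ring.
    by rewrite (ler_pM2l (dX_gt0 _)).
  rewrite normrM (gtr0_norm (dX_gt0 _)).
  have -> : 28 * (P * (k%:R * eps2)) = d ^+ b * (28 * (k%:R ^+ 2 * (al ^+ (k * p) * eps2))).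
    by rewrite /P; ring.
  by rewrite (ler_pM2l (dX_gt0 _)).
have n3 : `|d ^+ b * ga| <= ga ^+ 2 * (P * (k%:R * eps2)).
  rewrite ger0_norm; last by rewrite mulr_ge0 ?ltW // (lt_le_trans _ g1).
  have -> : ga ^+ 2 * (P * (k%:R * eps2))
     = d ^+ b * ga * (ga * (k%:R ^+ 2 * (al ^+ (k * p) * eps2))) by rewrite /P; ring.
  apply: ler_peMr; first by rewrite mulr_ge0 ?ltW // (lt_le_trans _ g1).
  have h1 : 1 <= al ^+ (k * p) * eps2.
    rewrite /eps2; have -> : (k * p = (p - m) * k + m * k)%N.
      by rewrite -mulnDl subnK ?geq_minl // mulnC.
    by rewrite exprD -mulrA alXi mulr1.
  rewrite -[X in X <= _]mulr1 ler_pM // -[X in X <= _]mulr1 ler_pM //.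
  by have := k3R; nra.
have h : `|(ga - 1) ^+ 2| * `|d ^+ a * (V n ^+ q - al ^+ N) - d ^+ b * (S1 - S2)|
   <= ga ^+ 2 * (28 * (Q * eps1) + 28 * (P * (k%:R * eps2))) by apply: ler_pM.
apply: le_trans (lerD h n3) _; rewrite -mulrDr.
apply: ler_wpM2l; first by rewrite exprn_ge0 // ltW // aX_gt0.
have gen (P0 Q0 e u : F) : Q0 * e <= 4 * P0 * e ->
    28 * (Q0 * e) + 28 * (P0 * u) + P0 * u <= P0 * (112 * e + 29 * u) by lra.
apply: (gen P Q eps1 (k%:R * eps2)).
by rewrite (ler_pM2r (iX_gt0 _)) Q_le_P.
Qed.

(** In the conjugate the powers of al become powers of i, and multiplying by P,
which is comparable to Q, compensates them. *)
Lemma conj_form_bound : P * `|norm_form p k N a b be al|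
  <= 2 * k%:R ^+ 2 * d ^+ (2 * b) * i ^+ p + 101 / 25 * d ^+ (2 * a).
Proof.
have e1 : i ^+ p <= 5 / 12.
  rewrite -(prednK p0) exprS; have := iX_le p.-1; have := iX_gt0 p.-1.
  by have := i0; have := i_le; nra.
have gbe : `|be ^+ p| = i ^+ p := norm_beX xy rp al12 p.
have hb : `|be ^+ p - 1| <= 17 / 12.
  by apply: le_trans (ler_normB _ _) _; rewrite gbe normr1; lra.
have nd r : `|(be - al) ^+ r| = d ^+ r by rewrite normrX distrC gtr0_norm // d_gt0.
have h1 : `|(be - al) ^+ b * (be ^+ p) ^+ k.+1 * (k%:R * (be ^+ p - 1) - 1)|
   <= d ^+ b * (i ^+ (k * p) * i ^+ p) * (2 * k%:R).
  rewrite normrM normrM nd normrX gbe -exprM mulnS addnC exprD (mulnC p).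
  apply: ler_wpM2l; first by rewrite !mulr_ge0 // ltW.
  apply: le_trans (ler_normB _ _) _; rewrite normrM normr_nat normr1.
  by have := k3R; move: hb; nra.
have h2 : `|(be - al) ^+ a * be ^+ N * (be ^+ p - 1) ^+ 2|
   <= d ^+ a * i ^+ N * (289 / 144).
  rewrite normrM normrM nd (norm_beX xy rp al12); apply: ler_wpM2l.
    by rewrite !mulr_ge0 // ltW.
  by rewrite normrX; have := normr_ge0 (be ^+ p - 1); nra.
have P0 := P_gt0.
have h3 : P * `|norm_form p k N a b be al|
   <= P * (d ^+ b * (i ^+ (k * p) * i ^+ p) * (2 * k%:R)) + P * (d ^+ a * i ^+ N * (289 / 144)).
  by rewrite -mulrDr (ler_pM2l P0); apply: le_trans (ler_normB _ _) _; apply: lerD.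
apply: le_trans h3 _; apply: lerD.
  have -> : P * (d ^+ b * (i ^+ (k * p) * i ^+ p) * (2 * k%:R))
    = 2 * k%:R ^+ 2 * (d ^+ b * d ^+ b) * i ^+ p * (al ^+ (k * p) * i ^+ (k * p)).
    by rewrite /P; ring.
  by rewrite alXi mulr1 -exprD mul2n addnn.
have h4 : P * (d ^+ a * i ^+ N * (289 / 144)) <= 2 * Q * (d ^+ a * i ^+ N * (289 / 144)).
  by rewrite ler_wpM2r ?P_le_Q // !mulr_ge0 ?ltW //; lra.
apply: le_trans h4 _.
have -> : 2 * Q * (d ^+ a * i ^+ N * (289 / 144))
  = 289 / 72 * (d ^+ a * d ^+ a) * (al ^+ N * i ^+ N) by rewrite /Q; field.
rewrite alXi mulr1 -exprD mul2n addnn; have := dX_gt0 a.*2; lra.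
Qed.

Let E := maxn (2 * b + p) (2 * a + 2 * p).

(** The norm of the form is a nonzero integer, so the product of the two bounds is
at least 1. *)
Lemma norm_inequality :
  1 <= (112 * eps1 + 29 * (k%:R * eps2)) * (62 * k%:R ^+ 2 * al ^+ E).
Proof.
have ab : a = 0%N \/ b = 0%N /\ (1 < p)%N by rewrite /a /b; lia.
have hc : conjugate al be (norm_form p k N a b al be) (norm_form p k N a b be al).
  exact: norm_form_conjugate rp.
have n1 := conjugate_norm_ge1 xy rp hc (norm_form_neq0 xy rp al12 N k3 p0 ab).
have f1 := form_bound; have f2 := conj_form_bound.
have P0 := P_gt0; set T := 112 * eps1 + _ in f1 *.
have T0 : 0 <= T.
  have kp : 0 < k%:R :> F by have := k3R; lra.
  have e1 : 0 < eps1 := iX_gt0 _; have e2 : 0 < k%:R * eps2 := mulr_gt0 kp (iX_gt0 _).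
  by rewrite /T; lra.
set W := 2 * _ * _ * _ + _ in f2.
have h : 1 <= ga ^+ 2 * T * W.
  apply: le_trans n1 _; rewrite normrM.
  apply: (@le_trans _ _ (ga ^+ 2 * (P * T) * `|norm_form p k N a b be al|)).
    by apply: ler_wpM2r.
  have -> (A B C D : F) : A * (B * C) * D = A * C * (B * D) by ring.
  by apply: ler_wpM2l => //; rewrite mulr_ge0 // exprn_ge0 // ltW // aX_gt0.
apply: le_trans h _; rewrite mulrAC mulrC; apply: ler_wpM2l => //.
have rho2 r : (r <= 10)%N -> d ^+ (2 * r) <= 25 * al ^+ (2 * r).
  move=> r10; rewrite diffE exprMn mulrC; apply: ler_wpM2r; first exact: ltW.
  have /andP[_ h] := rho_bounds.
  apply: (@le_trans _ _ ((169 / 144) ^+ (2 * r))).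
    by apply: lerXn2r; rewrite ?nnegrE //; have := rho_bounds; lra.
  apply: (@le_trans _ _ ((169 / 144) ^+ 20)); last by lra.
  by apply: ler_weXn2l; [lra|rewrite (leq_mul2l 2 r 10)].
have hb : d ^+ (2 * b) <= 25 * al ^+ (2 * b) by apply: rho2; rewrite /b; move: p0 q11; clear; lia.
have ha : d ^+ (2 * a) <= 25 * al ^+ (2 * a) by apply: rho2; rewrite /a; move: q0 p11; clear; lia.
have g2 : ga ^+ 2 = al ^+ (2 * p) by rewrite /ga -exprM mulnC.
have eb : ga ^+ 2 * (al ^+ (2 * b) * i ^+ p) <= al ^+ E.
  have -> : ga ^+ 2 = al ^+ p * al ^+ p by rewrite expr2.
  have -> (A B C : F) : A * A * (B * C) = B * A * (A * C) by ring.
  rewrite alXi mulr1 -exprD; apply: ler_weXn2l; last by rewrite leq_maxl.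
  by move: al12; lra.
have ea : ga ^+ 2 * al ^+ (2 * a) <= al ^+ E.
  rewrite g2 -exprD addnC; apply: ler_weXn2l; last by rewrite leq_maxr.
  by move: al12; lra.
have K2 : 9 <= k%:R ^+ 2 :> F by have := k3R; nra.
have K0 : 0 < k%:R ^+ 2 :> F by lra.
have G0 : 0 < ga ^+ 2 by rewrite exprn_gt0 // aX_gt0.
have h1 : W * ga ^+ 2 <= 50 * (k%:R ^+ 2 * al ^+ E) + 101 * al ^+ E.
  rewrite /W mulrDl; apply: lerD.
    apply: (@le_trans _ _ (2 * k%:R ^+ 2 * (25 * al ^+ (2 * b)) * i ^+ p * ga ^+ 2)).
      rewrite (ler_pM2r G0) (ler_pM2r (iX_gt0 p)) ler_pM2l // mulr_gt0 //.
    have -> : 2 * k%:R ^+ 2 * (25 * al ^+ (2 * b)) * i ^+ p * ga ^+ 2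
      = 50 * (k%:R ^+ 2 * (ga ^+ 2 * (al ^+ (2 * b) * i ^+ p))) by ring.
    by rewrite ler_pM2l // ler_pM2l.
  apply: (@le_trans _ _ (101 / 25 * (25 * al ^+ (2 * a)) * ga ^+ 2)).
    by rewrite (ler_pM2r G0) ler_pM2l //; lra.
  have -> : 101 / 25 * (25 * al ^+ (2 * a)) * ga ^+ 2 = 101 * (ga ^+ 2 * al ^+ (2 * a)).
    by field.
  by rewrite ler_pM2l.
rewrite mulrC; apply: le_trans h1 _; have := aX_gt0 E; move: K2.
by move: (k%:R ^+ 2) (al ^+ E) => u v; nra.
Qed.

(** One of the two errors contributes at least half of norm_inequality, and
2 * 112 * 62 <= 2^14, 2 * 29 * 62 <= 2^12. *)
Lemma norm_dichotomy :
  al ^+ (2 * n) <= 2 ^+ 14 * k%:R ^+ 2 * al ^+ E \/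
  al ^+ (m * k) <= 2 ^+ 12 * k%:R ^+ 3 * al ^+ E.
Proof.
have h := norm_inequality; have K0 : 0 < k%:R :> F by have := k3R; lra.
have a1 : al ^+ (2 * n) * eps1 = 1 := alXi _.
have a2 : al ^+ (m * k) * eps2 = 1 := alXi _.
have Y0 : 0 < k%:R ^+ 2 * al ^+ E by rewrite mulr_gt0 ?exprn_gt0 // al_gt0.
have e1 : 0 < eps1 := iX_gt0 _; have e2 : 0 < eps2 := iX_gt0 _.
have gen (A B e f K Y Z : F) : 0 < A -> 0 < B -> A * e = 1 -> B * f = 1 ->
   0 < e -> 0 < f -> 0 < K -> 0 < Y ->
   1 <= (112 * e + 29 * (K * f)) * (62 * Y) ->
   A <= 2 ^+ 14 * Y \/ B <= 2 ^+ 12 * (K * Y).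
  move=> A0 B0 Ae Bf e0 f0 K0' Y0' h'.
  have [h1|h1] := lerP 1 (e * (2 ^+ 14 * Y)); [left|right].
    rewrite -[leLHS]mulr1; apply: (@le_trans _ _ (A * (e * (2 ^+ 14 * Y)))).
      by rewrite ler_pM2l.
    by rewrite mulrA Ae mul1r.
  have h2 : 1 <= f * (2 ^+ 12 * (K * Y)).
    have : 0 < K * f * Y by rewrite !mulr_gt0.
    by lra.
  rewrite -[leLHS]mulr1; apply: (@le_trans _ _ (B * (f * (2 ^+ 12 * (K * Y))))).
    by rewrite ler_pM2l.
  by rewrite mulrA Bf mul1r.
rewrite -mulrA in h.
have := gen _ _ _ _ _ _ 0 (aX_gt0 _) (aX_gt0 _) a1 a2 e1 e2 K0 Y0 h.
by rewrite (exprS k%:R 2) !mulrA.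
Qed.

(** Comparing exponents of al in P_le_Q. *)
Lemma exponent_bound : (k * p + q <= n * q + p + 1)%N.
Proof.
have rb := rho_bounds; have rho0 : 0 < rho by lra.
have rl r : (r <= 10)%N -> 7 / 50 <= rho ^+ r <= 5.
  move=> r10; apply/andP; split.
    apply: (@le_trans _ _ ((119 / 144) ^+ r)).
      apply: (@le_trans _ _ ((119 / 144) ^+ 10)); first by lra.
      by apply: ler_wiXn2l => //; lra.
    by apply: lerXn2r; rewrite ?nnegrE //; lra.
  apply: (@le_trans _ _ ((169 / 144) ^+ r)).
    by apply: lerXn2r; rewrite ?nnegrE //; lra.
  apply: (@le_trans _ _ ((169 / 144) ^+ 10)); last by lra.
  by apply: ler_weXn2l => //; lra.
rewrite leqNgt; apply/negP => hlt.
have hN : (a + N + 2 <= b + k * p)%N.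
  by move: hlt; rewrite /a /b /N; clear; lia.
have h : rho ^+ b * k%:R * al ^+ (b + k * p) <= 2 * rho ^+ a * al ^+ (a + N).
  have := P_le_Q; rewrite /P /Q !diffE !exprMn !exprD.
  have -> (A B C D : F) : A * B * (C * D) = B * C * (A * D) by ring.
  by have -> (A B C : F) : 2 * (A * B * C) = 2 * B * (A * C) by ring.
have h1 : al ^+ 2 * al ^+ (a + N) <= al ^+ (b + k * p).
  by rewrite -exprD addnC ler_weXn2l //; move: al12; lra.
have [a1 b1 ab] : [/\ (a <= 10)%N, (b <= 10)%N & a = 0%N \/ b = 0%N].
  by rewrite /a /b; move: p0 q0 p11 q11; clear; split; lia.
have A0 := aX_gt0 (a + N).
have h2 : rho ^+ b * k%:R * (al ^+ 2 * al ^+ (a + N)) <= 2 * rho ^+ a * al ^+ (a + N).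
  by apply: le_trans h; apply: ler_wpM2l => //; rewrite mulr_ge0 // exprn_ge0 // ltW.
rewrite mulrA (ler_pM2r A0) in h2.
have a2 : 144 / 25 <= al ^+ 2 by move: al12; nra.
have h3 : rho ^+ b * 3 * (144 / 25) <= rho ^+ b * k%:R * al ^+ 2.
  have rb0 : 0 <= rho ^+ b by rewrite exprn_ge0 // ltW.
  have h4 : rho ^+ b * 3 <= rho ^+ b * k%:R by apply: ler_wpM2l.
  have h5 : 0 <= rho ^+ b * 3 by rewrite mulr_ge0.
  by apply: ler_pM => //; lra.
have /andP[ra1 ra2] := rl a a1; have /andP[rb1 rb2] := rl b b1.
case: ab => ab0; [have e : rho ^+ a = 1 by rewrite ab0|have e : rho ^+ b = 1 by rewrite ab0];
  rewrite e in h2 h3; lra.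
Qed.


(** form_bound divided by g^2, in terms of al^-p; the factor rho accounts for
al - be = al rho. *)
Lemma window :
  `|rho ^+ b * al ^+ (b + k * p) * (k%:R * (1 - i ^+ p) - i ^+ p)
    - rho ^+ a * al ^+ (a + N) * (1 - i ^+ p) ^+ 2|
  <= rho ^+ b * al ^+ (b + k * p) * (k%:R * (112 * eps1 + 29 * (k%:R * eps2))).
Proof.
have g2 : 0 < ga ^+ 2 by rewrite exprn_gt0 // aX_gt0.
rewrite -(ler_pM2l g2) -{1}(gtr0_norm g2) -normrM.
have h := form_bound; rewrite /P in h.
have dX r : d ^+ r = rho ^+ r * al ^+ r by rewrite diffE exprMn mulrC.
have -> : rho ^+ b * al ^+ (b + k * p) * (k%:R * (112 * eps1 + 29 * (k%:R * eps2)))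
   = d ^+ b * (k%:R * al ^+ (k * p)) * (112 * eps1 + 29 * (k%:R * eps2)).
  by rewrite dX exprD; ring.
have -> : ga ^+ 2 * (rho ^+ b * al ^+ (b + k * p) * (k%:R * (1 - i ^+ p) - i ^+ p)
    - rho ^+ a * al ^+ (a + N) * (1 - i ^+ p) ^+ 2) = norm_form p k N a b al be.
  rewrite /norm_form -/d !dX -/ga (mulnC k) !exprD (exprM al p k) -/ga (exprS ga k).
  have gi : ga * i ^+ p = 1 := alXi p.
  have -> : rho ^+ b * al ^+ b * (ga * ga ^+ k) * (k%:R * (ga - 1) - 1)
    = rho ^+ b * al ^+ b * (ga * ga ^+ k) * (k%:R * (ga - ga * i ^+ p) - ga * i ^+ p) by rewrite gi.
  have -> : rho ^+ a * al ^+ a * al ^+ N * (ga - 1) ^+ 2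
    = rho ^+ a * al ^+ a * al ^+ N * (ga - ga * i ^+ p) ^+ 2 by rewrite gi.
  ring.
exact: h.
Qed.

Section LargeX.
Hypothesis x20 : 20 <= x.

Let i_small : [/\ al <= x%:~R + i, x%:~R <= al + i, 199 / 10 <= al & i <= 10 / 199].
Proof.
have hb : `|be| <= i by rewrite (norm_be xy rp al12).
have [s _] := rp; move: hb; rewrite ler_norml => /andP[b1 b2].
have x20F : 20 <= x%:~R :> F by rewrite (ler_int F 20).
have a1 : 199 / 10 <= al.
  have h : 39 / 2 <= al by have := i_le; lra.
  have : i <= 2 / 39 by rewrite -(ler_pM2l al0) ali; lra.
  by lra.
split=> //; [lra|lra|].
by rewrite -(ler_pM2l al0) ali; lra.
Qed.

Lemma sq_inv_le j : (2 < j)%N -> j%:R ^+ 2 * i ^+ j <= 9 * i ^+ 3.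
Proof.
case: j => [|[|[|j]]] // _; elim: j => [|j IH].
  by rewrite le_eqVlt; apply/orP; left; apply/eqP; ring.
apply: le_trans IH; rewrite -(natr1 j.+3) (exprS i j.+3) mulrA.
apply: ler_wpM2r; first exact: ltW.
have j3 : 3 <= j.+3%:R :> F by rewrite ler_nat.
have [_ _ _ ii] := i_small; move: (j.+3%:R) j3 => u u3.
have : (u + 1) ^+ 2 * i <= (u + 1) ^+ 2 * (10 / 199) by rewrite ler_wpM2l // sqr_ge0.
by nra.
Qed.

Lemma rho_near1 r : (r <= 10)%N -> `|rho ^+ r - 1| <= 52 / 5 * i ^+ 2.
Proof.
move=> r10; have [_ _ _ ii] := i_small.
have hi : i ^+ 2 <= 1 / 396 by have := i0; nra.
have hw : `|- (be * i)| <= 1 / 396 by rewrite normrN norm_ratio.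
have c0 : 0 < 1 / 396 :> F by lra.
have := expr_near1_gen r c0 hw; rewrite -/rho normrN norm_ratio => h.
apply: le_trans h _; apply: ler_wpM2r; first by rewrite ltW // iX_gt0.
have : (1 + 1 / 396 : F) ^+ r <= (1 + 1 / 396) ^+ 10 by apply: ler_weXn2l => //; lra.
have -> : (1 / 396 : F)^-1 = 396 by field.
by lra.
Qed.

Lemma growth_error : k%:R * (112 * eps1 + 29 * (k%:R * eps2))
   <= 112 * (k%:R * i ^+ 4) + 261 * i ^+ 3.
Proof.
have h1 : eps1 <= i ^+ 4 by apply: ler_wiXn2l; [exact: ltW|exact: (iX_le 1)|lia].
have h2 : eps2 <= i ^+ k.
  apply: ler_wiXn2l; [exact: ltW|exact: (iX_le 1)|].
  by rewrite leq_pmull // /m leq_min p0.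
have h3 := sq_inv_le k3.
have K0 : 0 < k%:R :> F by have := k3R; lra.
have h4 : k%:R * eps1 <= k%:R * i ^+ 4 by rewrite ler_pM2l.
have h5 : k%:R ^+ 2 * eps2 <= k%:R ^+ 2 * i ^+ k by rewrite ler_pM2l // exprn_gt0.
have -> : k%:R * (112 * eps1 + 29 * (k%:R * eps2))
  = 112 * (k%:R * eps1) + 29 * (k%:R ^+ 2 * eps2) by ring.
lra.
Qed.

(** The quotient of the two leading terms is al^((a + N) - (b + k p)) up to factors
close to 1, and has to be close to k, which lies between 3 and 241 < al^2: so
the exponent is 1, and k is the integer nearest to al or al - 1. *)
Lemma large_x_index : (k <= 241)%N ->
  (n * q + p = k * p + q + 1)%N /\ k%:Z = x - (p == 1%N)%:Z.
Proof.
(* The numerical margins, which become comfortable once al >= 199/10. *)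
have n1 (e K i3 i4 : F) : e <= 112 * i4 + 261 * i3 -> i3 <= 1 / 396 * (10 / 199) ->
    i4 <= K * (1 / 396 * (1 / 396)) -> 3 <= K -> e <= 1 / 1000 * K + 34 / 1000 by lra.
have n2' (K g : F) : K * g <= K * (10 / 199) -> g <= 10 / 199 -> 3 <= K ->
    94 / 100 * K - 6 / 100 <= K * (1 - g) - g by lra.
have n3 (K g : F) : 0 <= K * g -> 0 < g -> K * (1 - g) - g <= K by lra.
have n4 (g : F) : 0 < g -> g <= 10 / 199 -> 9 / 10 <= (1 - g) ^+ 2 /\ (1 - g) ^+ 2 <= 1.
  by move=> h1 h2; split; nra.
have n5 (K e kap : F) : 94 / 100 * K - 6 / 100 <= kap -> e <= 1 / 1000 * K + 34 / 1000 ->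
    3 <= K -> 5 / 2 <= kap - e by lra.
have n6 (K e kap : F) : 94 / 100 * K - 6 / 100 <= kap -> 0 <= e -> 3 <= K -> 0 <= kap + e by lra.
have n7 (K e kap : F) : kap <= K -> e <= 1 / 1000 * K + 34 / 1000 -> K <= 241 ->
    kap + e <= 243 by lra.
have n8 (K : F) : K <= 113 / 100 * al + 1 / 8 -> 199 / 10 <= al -> K <= 114 / 100 * al by lra.
have n9 (e i3 i4 : F) : e <= 112 * i4 + 261 * i3 -> i4 <= 114 / 100 * i3 ->
    i3 <= 1 / 396 * (10 / 199) -> e <= 1 / 20 by lra.
have n10 (z j : F) : al <= z + j -> z <= al + j -> j <= 10 / 199 -> `|al - z| <= 10 / 199.
  by move=> *; rewrite ler_norml; apply/andP; split; lra.
have n11 (u v : F) : v <= 10 / 199 -> u <= 9 / 10 -> u + v < 1 by lra.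
have n12 (X j : F) : `|X - 1| <= 52 / 5 * j -> j <= 1 / 396 -> 97 / 100 <= X /\ X <= 103 / 100.
  by rewrite ler_norml => /andP[? ?] ?; split; lra.
have n13 (X : F) : 97 / 100 <= X -> 0 <= X by lra.
have n14 (h : F) : 9 / 10 <= h -> 0 <= h by lra.
have n15 : 199 / 10 <= al -> 396 <= al ^+ 2 by nra.
have n16 (u v : F) : 0 < u -> 0 < v -> 0 <= 112 * u + 29 * v by lra.
have K0 : 0 < k%:R :> F by have := k3R; lra.
have n17 (j : F) : 0 < j -> j <= 10 / 199 -> j ^+ 2 <= 1 / 396 by nra.
have al1 : 1 <= al by move: al12; lra.
move=> k241; have [xa1 xa2 a199 ii] := i_small.
have k241F : k%:R <= 241 :> F by rewrite (ler_nat F k 241).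
have hi2 : i ^+ 2 <= 1 / 396 by apply: n17.
have hi3 : i ^+ 3 <= 1 / 396 * (10 / 199).
  by rewrite exprSr; apply: ler_pM => //; [apply: ltW|apply: ltW].
have hi4 : i ^+ 4 <= 1 / 396 * (1 / 396).
  by rewrite (exprD i 2 2); apply: ler_pM => //; apply: ltW.
have [a10 b10 ab] : [/\ (a <= 10)%N, (b <= 10)%N & a = 0%N \/ b = 0%N].
  by rewrite /a /b; move: p0 q0 p11 q11; clear; split; lia.
have hX := rho_near1 b10; have hY := rho_near1 a10.
set X := rho ^+ b in hX *; set Y := rho ^+ a in hY *.
have [X1 X2] := n12 _ _ hX hi2; have [Y1 Y2] := n12 _ _ hY hi2.
set g := i ^+ p; have g0 : 0 < g := iX_gt0 p.
have g1 : g <= i.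
  by rewrite -[leRHS]expr1; apply: ler_wiXn2l; [exact: ltW|exact: (iX_le 1)|].
have he := growth_error; set e := k%:R * (112 * _ + _) in he *.
have e0 : 0 <= e.
  have e1 : 0 < eps1 := iX_gt0 _; have e2 : 0 < k%:R * eps2 := mulr_gt0 K0 (iX_gt0 _).
  by rewrite mulr_ge0 ?(ltW K0) // n16.
have e_le : e <= 1 / 1000 * k%:R + 34 / 1000.
  have : k%:R * i ^+ 4 <= k%:R * (1 / 396 * (1 / 396)) by rewrite ler_wpM2l.
  by move=> h4; apply: n1 he hi3 h4 k3R.
have W := window; rewrite -/X -/Y -/g -/e in W.
set A := al ^+ (b + k * p) in W; have A0 : 0 < A := aX_gt0 _.
set kap := k%:R * (1 - g) - g in W.
have kg : k%:R * g <= k%:R * (10 / 199) by rewrite ler_wpM2l //; apply: le_trans g1 ii.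
have kg0 : 0 <= k%:R * g by rewrite mulr_ge0 // ltW.
have kap1 : 94 / 100 * k%:R - 6 / 100 <= kap.
  exact: n2' kg (le_trans g1 ii) k3R.
have kap2 : kap <= k%:R by exact: n3.
have [h9 h1] := n4 g g0 (le_trans g1 ii).
have eN : (a + N = b + k * p + 1)%N.
  have [hN|hN|//] := ltngtP (a + N) (b + k * p + 1).
    case: (window_small A0 (ltW (aX_gt0 (a + N))) _ X1 _ Y2 _ h1 _ W).
    - by apply: ler_weXn2l; [exact: al1|move: hN; clear; lia].
    - exact: n13.
    - exact: n14.
    exact: n5 kap1 e_le k3R.
  case: (window_large A0 _ _ X2 Y1 h9 _ _ W).
  - apply: (@le_trans _ _ (al ^+ 2 * A)).
      by rewrite ler_pM2r // n15.
    rewrite -exprD addnC; apply: ler_weXn2l => //.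
    by move: hN; clear; lia.
  - exact: n13.
  - exact: n6 kap1 e0 k3R.
  exact: n7 kap2 e_le k241F.
split; first by move: eN; rewrite /a /b /N; clear; lia.
rewrite eN addn1 exprS -/A in W.
have W' : `|X * kap - Y * al * (1 - g) ^+ 2| <= X * e.
  rewrite -(ler_pM2l A0) -{1}(gtr0_norm A0) -normrM.
  have -> : A * (X * kap - Y * al * (1 - g) ^+ 2)
    = X * A * kap - Y * (al * A) * (1 - g) ^+ 2 by ring.
  by rewrite [leRHS]mulrCA [leRHS]mulrA.
have kal := window_index_le ali i0 ii k3R g0 g1 W' X1 Y2 e_le.
have e_small : e <= 1 / 20.
  have h2 : k%:R * i ^+ 4 <= 114 / 100 * i ^+ 3.
    have -> : 114 / 100 * i ^+ 3 = 114 / 100 * al * i ^+ 4.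
      by rewrite (exprS i 3) -[RHS]mulrA (mulrA al) ali mul1r.
    by rewrite ler_pM2r // n8.
  exact: n9 he h2 hi3.
have XY : X = 1 \/ Y = 1 by rewrite /X /Y; case: ab => ->; auto.
have C := window_center ali i0 ii k3R g0 g1 W' XY hX hY e0 e_small kal.
suff : `|k%:R - x%:~R + (p == 1%N)%:R| < 1 :> F.
  have -> : k%:R - x%:~R + (p == 1%N)%:R = (k%:Z - x + (p == 1%N)%:Z)%:~R :> F.
    by rewrite rmorphD rmorphB.
  rewrite -intr_norm (_ : 1 = 1%:~R) // ltr_int.
  by move: (p == 1%N)%:Z; clear; lia.
have -> : k%:R - x%:~R + (p == 1%N)%:R
  = (k%:R - al + (p == 1%N)%:R) + (al - x%:~R) :> F by ring.
apply: le_lt_trans (ler_normD _ _) _.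
have hx : `|al - x%:~R| <= 10 / 199.
  exact: n10 xa1 xa2 ii.
suff : `|k%:R - al + (p == 1%N)%:R| <= 9 / 10 by apply: n11.
case: eqP => p1.
  have gi : g = i by rewrite /g p1 expr1.
  exact: (window_index1 ali i0 ii gi C).
rewrite addr0; apply: (window_index2 ali i0 ii k3R g0 g1 _ kal C).
by rewrite /g; apply: ler_wiXn2l; [exact: ltW|exact: (iX_le 1)|move: p0 p1; clear; lia].
Qed.

End LargeX.

(** The constant 240 is dictated by p = 1, q = 11. *)
Lemma index_bound : (k <= 240 %/ p + p)%N.
Proof.
apply: (index_bound_nat p0 q0 p11 q11 exponent_bound) => j kj.
have [h|h] := norm_dichotomy; [left|right].
  exact: (log_compare al12 (isT : (0 < 2)%N) kj h).
exact: (log_compare al12 (isT : (0 < 3)%N) kj h).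
Qed.

End Estimates.

Lemma lucas_roots (x y : int) : lucas_range x y ->
  exists2 ab : realalg * realalg, root_pair x y ab.1 ab.2 & 12 / 5 <= ab.1.
Proof.
move=> xy; pose X : realalg := x%:~R; pose Y : realalg := y%:~R.
have [X2 D0] : 2 <= X /\ (14 / 5 <= Num.sqrt (X ^+ 2 - 4 * Y) \/
    3 <= X /\ 2 <= Num.sqrt (X ^+ 2 - 4 * Y)).
  have sq (u v : realalg) : 0 <= u -> u ^+ 2 <= v -> u <= Num.sqrt v.
    by move=> u0 uv; rewrite -(ger0_norm u0) -sqrtr_sqr ler_wsqrtr.
  rewrite /X /Y; case: xy => -[-> hx]; move: hx; rewrite -(ler_int realalg) => hx.
    by split=> //; left; apply: sq; [lra|nra].
  by split; [lra|right; split=> //; apply: sq; [lra|nra]].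
have DP : 0 <= X ^+ 2 - 4 * Y.
  rewrite leNgt; apply/negP => /ltW /ler0_sqrtr s0; move: D0; rewrite s0.
  by case=> [|[]]; lra.
have ss := sqr_sqrtr DP; move: D0 ss; set s := Num.sqrt _ => D0 ss.
exists ((X + s) / 2, (X - s) / 2) => /=; last by case: D0 => [|[]]; lra.
split=> /=; first by rewrite -/X; field.
rewrite -/Y; have -> : (X + s) / 2 * ((X - s) / 2) = (X ^+ 2 - s ^+ 2) / 4 by field.
by rewrite ss; field.
Qed.

Lemma power_sum_eq_constraints (x y : int) (p q k n : nat) :
  lucas_range x y -> (0 < p)%N -> (0 < q)%N -> (p <= 11)%N -> (q <= 11)%N ->
  (2 < k)%N -> (0 < n)%N -> power_sum x y p k = lucasU x y n ^+ q ->
  (k <= 240 %/ p + p)%N /\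
  (20 <= x -> (n * q + p = k * p + q + 1)%N /\ k%:Z = x - (p == 1%N)%:Z).
Proof.
move=> xy p0 q0 p11 q11 k3 n0 eqS.
have n2 : (1 < n)%N.
  case: n n0 eqS => [|[|n]] // _; rewrite /= expr1n => eqS.
  have [_ /(_ (ltnW (ltnW k3)))] := power_sum_ge p k xy; rewrite eqS.
  have : 1 <= lucasU x y k ^+ p.
    by rewrite exprn_ege1 //; have := lucasU_gt0 xy (ltnW (ltnW k3)); lia.
  by move: k3; set u := _ ^+ p; clearbody u; clear; nia.
have [[al be] /= rp al12] := lucas_roots xy.
have kp := index_bound xy rp al12 p0 q0 p11 q11 k3 n2 eqS.
split=> // x20; apply: (large_x_index xy rp al12 p0 q0 p11 q11 k3 n2 eqS x20).
apply: leq_trans kp _; case: p p0 p11 {eqS} => [|[|p]] // _ p11.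
have : (240 %/ p.+2 <= 240 %/ 2)%N by apply: leq_div2l.
have -> : (240 %/ 2 = 120)%N by [].
by move: p11; move: (240 %/ _)%N => u; lia.
Qed.

(** * The sum equation for x >= 20 *)

(** The residue of the sum: only odd j contribute, and U_(2i+1)^p is (- y)^(i p). *)
Fixpoint odd_sum (e : int) (h : nat) : int :=
  if h is h'.+1 then odd_sum e h' + (2 * h'%:Z + 1) * e ^+ h' else 0.

Lemma odd_sum1 h : odd_sum 1 h = h%:Z ^+ 2.
Proof. by elim: h => //= h ->; rewrite expr1n intS; ring. Qed.

Lemma odd_sumN1 h : odd_sum (-1) h = - (-1) ^+ h * h%:Z.
Proof. by elim: h => //= h ->; rewrite exprS intS; ring. Qed.

Lemma odd_sumS e h : odd_sum e h.+1 = odd_sum e h + (2 * h%:Z + 1) * e ^+ h.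
Proof. by []. Qed.

Lemma power_sum_mod x y d p h : y * y = 1 -> (d %| x ^+ 2)%Z ->
  (forall i, d %| lucasU x y i.*2 ^+ p)%Z ->
  (d %| power_sum x y p h.*2 - odd_sum ((- y) ^+ p) h)%Z /\
  (d %| power_sum x y p h.*2.+1 - odd_sum ((- y) ^+ p) h.+1)%Z.
Proof.
move=> y2 dx dU.
have step i : (d %| power_sum x y p i.*2 - odd_sum ((- y) ^+ p) i)%Z ->
    (d %| power_sum x y p i.*2.+1 - odd_sum ((- y) ^+ p) i.+1)%Z.
  move=> IH; rewrite power_sumS odd_sumS.
  have -> (A B C D u : int) : A + C * B - (D + u) = (A - D) + (C * B - u) by ring.
  rewrite rpredD // -(exprM (- y)) mulnC exprM.
  have [_ [t ->]] := lucasU_mod_sq x i y2.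
  have -> : i.*2.+1%:Z = 2 * i%:Z + 1 by rewrite -mul2n intS PoszM addrC.
  rewrite -mulrBr dvdz_mull // subrXX dvdz_mulr //.
  by rewrite addrAC subrr add0r dvdz_mull.
elim: h => [|h [_ IH]].
  have h0 : (d %| power_sum x y p 0.*2 - odd_sum ((- y) ^+ p) 0)%Z.
    by rewrite /power_sum big_geq // subrr dvdz0.
  by split=> //; apply: step.
have h1 : (d %| power_sum x y p h.+1.*2 - odd_sum ((- y) ^+ p) h.+1)%Z.
  by rewrite doubleS power_sumS addrAC rpredD // dvdz_mull // -doubleS.
by split=> //; apply: step.
Qed.

Lemma lucasU_even_dvd x y i : y * y = 1 -> (x %| lucasU x y i.*2)%Z.
Proof.
move=> y2; have [[t ->] _] := lucasU_mod_sq x i y2.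
by rewrite rpredD ?dvdz_mull // exprS dvdz_mulr.
Qed.

Lemma sgn_cases (y : int) i : y = 1 \/ y = -1 -> (- y) ^+ i = 1 \/ (- y) ^+ i = -1.
Proof.
case=> ->; last by rewrite opprK expr1n; left.
rewrite -signr_odd; case: odd; first by right; rewrite expr1.
by left; rewrite expr0.
Qed.

Lemma dvdz_small (d a : int) : (d %| a)%Z -> `|a| < d -> a = 0.
Proof.
move=> /dvdzP[c ->]; rewrite normrM => h.
have d0 : 0 < d by lia.
have : `|c| < 1 by rewrite -(ltr_pM2r d0) mul1r; move: h; rewrite (gtr0_norm d0).
by move=> c1; apply/eqP; rewrite mulf_eq0; apply/orP; left; lia.
Qed.

Lemma lucasU_pow_mod x y n q : y = 1 \/ y = -1 -> (0 < q)%N ->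
  exists2 e, (e = 0 \/ e = 1 \/ e = -1) & (x %| lucasU x y n ^+ q - e)%Z.
Proof.
move=> y1 q0; have y2 : y * y = 1 by case: y1 => ->.
rewrite -(odd_double_half n); case: odd.
  have [_ [t ->]] := lucasU_mod_sq x n./2 y2.
  exists ((- y) ^+ (n./2 * q)); first by right; exact: sgn_cases.
  by rewrite exprM subrXX dvdz_mulr // addrAC subrr add0r expr2 mulrA dvdz_mull.
by exists 0; [left|rewrite subr0 add0n dvdz_exp // lucasU_even_dvd].
Qed.

(** For p = 1 the even terms also matter modulo x^2: they add 2 x (1^2 + ... + h^2);
the factor 3 clears the denominator. *)
Lemma power_sum1_mod x h : exists t,
  3 * power_sum x (-1) 1 h.*2.+1
  = 3 * h.+1%:Z ^+ 2 + x * (h%:Z * h.+1%:Z * (2 * h%:Z + 1)) + t * x ^+ 2.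
Proof.
have U i : (exists t, lucasU x (-1) i.*2 = i%:Z * x + t * x ^+ 3) /\
   (exists t, lucasU x (-1) i.*2.+1 = 1 + t * x ^+ 2).
  by have := @lucasU_mod_sq x (-1) i (erefl _); rewrite opprK !expr1n mul1r.
elim: h => [|h [t IH]].
  by exists 0; rewrite /power_sum big_nat1 /=; ring.
have [_ [u Uo]] := U h.+1; have [[v Ue] _] := U h.+1.
rewrite doubleS power_sumS power_sumS -doubleS Uo Ue !expr1.
exists (t + 3 * h.+1.*2%:Z * v * x + 3 * h.+1.*2.+1%:Z * u).
have e1 : h.+1.*2%:Z = 2 * h%:Z + 2 by rewrite -mul2n PoszM intS; ring.
have e2 : h.+1.*2.+1%:Z = 2 * h%:Z + 3 by rewrite intS e1; ring.
have e3 : h.+2%:Z = h%:Z + 2 by rewrite !intS; ring.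
rewrite !mulrDr IH e1 e2 e3 (intS h); ring.
Qed.

Lemma power_sum_mod_uphalf x y d p k : y * y = 1 -> (d %| x ^+ 2)%Z ->
  (forall i, d %| lucasU x y i.*2 ^+ p)%Z ->
  (d %| power_sum x y p k - odd_sum ((- y) ^+ p) (uphalf k))%Z.
Proof.
move=> y2 dx dU; have [h1 h2] := power_sum_mod k./2 y2 dx dU.
rewrite uphalf_half -{1}(odd_double_half k).
by case: odd; [rewrite !add1n|rewrite !add0n].
Qed.

(** Modulo 4 H^2, the number H^2 is neither 0 nor 1 up to sign. If q = 1 and n = 2m,
it would be 2 m H up to sign; as the relation on n makes m equal to 1 - p / 2
modulo 2 H, the number H would be 2 - p up to sign modulo 4 H. *)
Lemma no_large_even_ge2 (x y : int) (p q k n H : nat) (S : int) :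
  y = 1 \/ y = -1 -> x = 2 * H%:Z -> (10 <= H)%N -> (1 < p <= 11)%N -> (0 < q)%N ->
  (n * q + p = k * p + q + 1)%N -> k = H.*2 ->
  (x ^+ 2 %| S - H%:Z ^+ 2)%Z -> S <> lucasU x y n ^+ q.
Proof.
move=> y1 xE H10 p11 q0 nk kE dS SE; rewrite {S}SE in dS.
have y2 : y * y = 1 by case: y1 => ->.
have [m nE] : exists m, n = m.*2.+1 \/ n = m.*2.
  by exists n./2; rewrite -{1 3}(odd_double_half n); case: odd; [left|right].
have big (a : int) : (x ^+ 2 %| H%:Z ^+ 2 - a)%Z -> `|a| <= 1 -> False.
  move=> da a1; have : H%:Z ^+ 2 - a = 0.
    by apply: dvdz_small da _; rewrite xE; move: H10 a1; clear; nia.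
  by move: H10 a1; clear; nia.
have sub (a : int) : (x ^+ 2 %| lucasU x y n ^+ q - a)%Z -> (x ^+ 2 %| H%:Z ^+ 2 - a)%Z.
  move=> da; have -> : H%:Z ^+ 2 - a
    = (lucasU x y n ^+ q - a) - (lucasU x y n ^+ q - H%:Z ^+ 2) by ring.
  by rewrite rpredB.
case: nE => nE.
  have [_ [t Ut]] := lucasU_mod_sq x m y2.
  apply: (big ((- y) ^+ m ^+ q)).
    by apply: sub; rewrite nE Ut subrXX dvdz_mulr // addrAC subrr add0r dvdz_mull.
  by rewrite -exprM; case: (sgn_cases (m * q) y1) => ->.
have [[t Ut] _] := lucasU_mod_sq x m y2.
case: q q0 nk dS sub => [|[|q]] // _ nk dS sub; last first.
  apply: (big 0) => //; apply: sub; rewrite subr0.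
  have -> : lucasU x y n ^+ q.+2 = lucasU x y n * lucasU x y n * lucasU x y n ^+ q.
    by rewrite !exprS mulrA.
  by rewrite dvdz_mulr // expr2 dvdz_mul // nE lucasU_even_dvd.
have [p' pE] : exists p', p = p'.*2.
  exists p./2; have : ~~ odd p.
    move: nk; rewrite nE kE; clear; lia.
  by move=> hp; rewrite -{1}(odd_double_half p) (negbTE hp).
have mE : m%:Z = 2 * H%:Z * p'%:Z + 1 - p'%:Z.
  by move: nk; rewrite nE kE pE -!mul2n; clear; lia.
have [s s1 Us] : exists2 s, s = 1 \/ s = -1 & lucasU x y n = s * m%:Z * x + t * x ^+ 3.
  by exists ((- y) ^+ m.+1); rewrite ?nE //; apply: sgn_cases.
rewrite expr1 Us in dS; have /dvdzP[c cE] := dS.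
have cH : 2 * s * m%:Z - H%:Z = 4 * H%:Z * (c - t * x).
  apply: (@mulfI _ H%:Z); first by move: H10; clear; lia.
  have -> : H%:Z * (4 * H%:Z * (c - t * x)) = c * x ^+ 2 - t * x ^+ 3 by rewrite xE; ring.
  by rewrite -cE xE; ring.
have d4 : (4 * H%:Z %| 2 * s * (1 - p'%:Z) - H%:Z)%Z.
  apply/dvdzP; exists (c - t * x - s * p'%:Z).
  have -> : 2 * s * (1 - p'%:Z) - H%:Z = 2 * s * m%:Z - H%:Z - 4 * H%:Z * (s * p'%:Z) by rewrite mE; ring.
  by rewrite cH; ring.
have := dvdz_small d4; case: s1 => ->; move: p11 H10; rewrite pE -mul2n; clear.
  by move=> h1 h2 h3; have := h3 ltac:(lia); lia.
by move=> h1 h2 h3; have := h3 ltac:(lia); lia.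
Qed.

(** Here n is even. Modulo 4 H^2 with H = h + 1, three times the sum is an odd
multiple of H^2, while U_n^q is an even one. *)
Lemma no_large_even_1 (x : int) (q k n h : nat) (S : int) :
  x = 2 * h.+1%:Z -> (10 <= h.+1)%N -> (0 < q)%N ->
  (n * q + 1 = k + q + 1)%N -> k = h.*2.+1 ->
  (exists t, 3 * S = 3 * h.+1%:Z ^+ 2 + x * (h%:Z * h.+1%:Z * (2 * h%:Z + 1)) + t * x ^+ 2) ->
  S <> lucasU x (-1) n ^+ q.
Proof.
move=> xE H10 q0 nk kE [t St] SE; rewrite {S}SE in St.
have nq : (n.-1 * q = h.*2.+1)%N.
  case: n nk {St} => [|n]; rewrite kE -?mul2n; clear; first lia.
  by rewrite mulSn /=; lia.
have n_odd : odd n.-1.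
  have : odd (n.-1 * q) by rewrite nq /= odd_double.
  by rewrite oddM => /andP[].
have [m nE] : exists m, n = m.*2.
  exists (n.-1)./2.+1; rewrite doubleS -[n.-1./2.*2.+1]/(true + _)%N -n_odd odd_double_half.
  by case: n n_odd {nk St nq}.
have [[u Uu] _] := @lucasU_mod_sq x (-1) m (erefl _).
rewrite opprK expr1n mul1r -nE in Uu.
set K := h.+1%:Z in St xE *.
have [v Uv] : exists v, lucasU x (-1) n ^+ q = K ^+ 2 * (2 * v).
  case: q q0 nk nq {St} => [|[|q]] // _ nk nq.
    have mE : m%:Z = K.
      rewrite /K; move: nq nE; rewrite muln1 -!mul2n; clear.
      by case: n => [|n]; lia.
    by exists (1 + 4 * u * K); rewrite expr1 Uu mE xE; ring.
  have /dvdzP[c Uc] : (x %| lucasU x (-1) n)%Z by rewrite nE lucasU_even_dvd.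
  by exists (2 * (c ^+ 2 * lucasU x (-1) n ^+ q)); rewrite !exprS Uc xE expr0; ring.
have K0 : K ^+ 2 != 0 by rewrite expf_neq0 // /K.
have : 6 * v = 3 + 2 * (h%:Z * (2 * h%:Z + 1)) + 4 * t.
  apply: (mulfI K0).
  have -> : K ^+ 2 * (6 * v) = 3 * (K ^+ 2 * (2 * v)) by ring.
  by rewrite -Uv St xE; ring.
by move: (h%:Z * _) => z; clear; lia.
Qed.

(** Let H be the number of odd indices up to k, so that 2 H is x - 1, x or x + 1.
Modulo x the sum is H^2, or H up to sign, and the right side is 0, 1 or -1. This
forces x = 2 H and the sum to be H^2. *)
Lemma no_large_x (x y : int) (p q k n : nat) :
  lucas_range x y -> 20 <= x -> (0 < p)%N -> (0 < q)%N -> (p <= 11)%N ->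
  (n * q + p = k * p + q + 1)%N -> k%:Z = x - (p == 1%N)%:Z ->
  power_sum x y p k <> lucasU x y n ^+ q.
Proof.
move=> xy x20 p0 q0 p11 nk kx eqS.
have y1 : y = 1 \/ y = -1 by case: xy => -[]; auto.
have y2 := lucas_range_sq xy.
have [e e01 de] := lucasU_pow_mod x n y1 q0.
have dx : (x %| x ^+ 2)%Z by rewrite dvdz_mulr.
have dUx i : (x %| lucasU x y i.*2 ^+ p)%Z by rewrite dvdz_exp // lucasU_even_dvd.
have dS := power_sum_mod_uphalf k y2 dx dUx; rewrite eqS in dS.
set H := uphalf k in dS.
have kH : k = H.*2 \/ k.+1 = H.*2.
  have := odd_double_half k; rewrite /H uphalf_half -!mul2n; clear.
  by case: odd => /=; lia.
have pc : (p == 1%N)%:Z = 0 \/ (p == 1%N)%:Z = 1 by case: (p == 1%N); [right|left].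
have dH : (x %| odd_sum ((- y) ^+ p) H - e)%Z.
  have -> : odd_sum ((- y) ^+ p) H - e
    = (lucasU x y n ^+ q - e) - (lucasU x y n ^+ q - odd_sum ((- y) ^+ p) H) by ring.
  by rewrite rpredB.
have Hx : 2 * H%:Z = k%:Z \/ 2 * H%:Z = k%:Z + 1.
  by move: kH; rewrite -mul2n; clear; lia.
have [ep|ep] := sgn_cases p y1; last first.
  rewrite ep odd_sumN1 in dH.
  have [s s1 sE] : exists2 s, s = 1 \/ s = -1 & - (-1) ^+ H = s :> int.
    by have [->|->] := @sgn_cases 1 H (or_introl erefl); [exists (-1); auto|exists 1; rewrite ?opprK; auto].
  rewrite sE in dH.
  have := dvdz_small dH; move: Hx e01 kx pc x20 s1; clear => Hx e01 kx pc x20 s1 h.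
  have : s * H%:Z - e = 0 by apply: h; case: s1 => ->; lia.
  by case: s1 => ->; lia.
rewrite ep odd_sum1 in dH.
have xH : x = 2 * H%:Z.
  have [c [c1 cE]] : exists c, [\/ c = -1, c = 0 | c = 1] /\ 2 * H%:Z = x + c.
    exists (2 * H%:Z - x); split; last by ring.
    by move: Hx kx pc; clear => Hx kx pc; case: Hx; case: pc; [constructor 2|constructor 1|constructor 3|constructor 2]; lia.
  have d4 : c <> 0 -> (x %| 1 - 4 * e)%Z.
    move=> c0; have -> : 1 - 4 * e = 4 * (H%:Z ^+ 2 - e) - x * (x + 2 * c).
      have -> : 4 * (H%:Z ^+ 2 - e) = (2 * H%:Z) ^+ 2 - 4 * e by ring.
      have cc : c * c = 1 by case: c1 => // ->.
      rewrite cE; have -> : (x + c) ^+ 2 - 4 * e - x * (x + 2 * c) = c * c - 4 * e by ring.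
      by rewrite cc.
    by apply: rpredB; [exact: dvdz_mull|exact: dvdz_mulr].
  have e5 : `|1 - 4 * e| < x by move: e01 x20; clear; lia.
  have [c0|c0] := eqVneq c 0; first by rewrite cE c0 addr0.
  by have := dvdz_small (d4 (elimN eqP c0)) e5; move: e01; clear; lia.
have H10 : (10 <= H)%N by move: x20; rewrite xH; clear; lia.
have [p1|p1] := eqVneq p 1%N; last first.
  have kE : k = H.*2 by move: kx; rewrite (negbTE p1) subr0 xH -mul2n; clear; lia.
  have p2 : (1 < p <= 11)%N by rewrite p11 andbT; move: p0 p1; clear; lia.
  apply: (no_large_even_ge2 y1 xH H10 p2 q0 nk kE _ eqS).
  have dU2 i : (x ^+ 2 %| lucasU x y i.*2 ^+ p)%Z.
    case: p p2 {eqS nk kx dUx dS pc dH ep p0 p11 p1} => [|[|p]] // _.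
    by rewrite !exprS mulrA mulr1 dvdz_mulr // dvdz_mul // lucasU_even_dvd.
  by have := power_sum_mod_uphalf k y2 (dvdzz _) dU2; rewrite ep odd_sum1.
have yE : y = -1 by case: y1 ep => -> //; rewrite p1 expr1.
case EH : H H10 => [|h] // H10; rewrite EH in xH kx Hx kH.
subst p y; rewrite eqxx /= in kx.
have kE : k = h.*2.+1 by move: kx; rewrite xH -mul2n; clear; lia.
apply: (no_large_even_1 xH H10 q0 _ kE _ eqS).
  by move: nk; clear; lia.
by rewrite kE; apply: power_sum1_mod.
Qed.

(** * The sum equation for x < 20 *)

Fixpoint lucas_residues (M X Y a b : Z) (T : nat) : seq Z :=
  if T is T'.+1 then
    a :: lucas_residues M X Y b (Z.modulo (Z.sub (Z.mul X b) (Z.mul Y a)) M) T'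
  else [::].

Definition mul_rows (M : Z) (r s : seq Z) : seq Z :=
  [seq Z.modulo (Z.mul u.1 u.2) M | u <- zip r s].

Fixpoint power_rows (M : Z) (base row : seq Z) (q : nat) : seq (seq Z) :=
  if q is q'.+1 then row :: power_rows M base (mul_rows M base row) q' else [::].

(** Shifted by one, so that the residue 0 gets a key too. *)
Definition key (z : Z) : positive := Z.to_pos (Z.succ z).

Definition residue_set (l : seq Z) : PositiveSet.t :=
  foldr (fun z s => PositiveSet.add (key z) s) PositiveSet.empty l.

Fixpoint sums_avoid (M : Z) (L : PositiveSet.t) (k S : Z) (l : seq Z) : bool :=
  if l is u :: l' then
    let S' := Z.add S (Z.mul k u) in
    (Z.ltb k 3 || ~~ PositiveSet.mem (key (Z.modulo S' M)) L)
      && sums_avoid M L (Z.succ k) S' l'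
  else true.

(** The certificate is a modulus M with a period T of U modulo M. The check is that
U_T = 0 and U_(T+1) = 1 modulo M, and that no sum with 3 <= k <= 240 / p + p
is congruent to any U_i^q with i < T and q <= 11. Since T >= 10, 26 periods
cover all the indices needed. *)
Definition certified (X Y : Z) (c : Z * nat) : bool :=
  let M := c.1 in let T := c.2 in
  let r := lucas_residues M X Y Z0 (Zpos xH) T.+2 in
  let base := take T r in
  let rows := power_rows M base base 11 in
  let L := residue_set (flatten rows) in
  [&& Z.ltb 1 M, (10 <= T)%N,
      (if drop T r is [:: a; b] then Z.eqb a Z0 && Z.eqb b (Zpos xH) else false)
    & all (fun pr => sums_avoid M L (Zpos xH) Z0
             (take (240 %/ pr.1 + pr.1) (behead (flatten (nseq 26 pr.2)))))
          (zip (iota 1 11) rows)].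

(** For x = 2, 3, ... and y = -1: divisors M of gcd(U_T, U_(T+1) - 1), for small T,
chosen so that the few residues of U_n^q miss all the sums. *)
Definition table_neg : seq (Z * nat) :=
 [:: (Zpos 374974, 78%N); (Zpos 2683659, 88%N); (Zpos 394418, 66%N);
     (Zpos 392705, 42%N); (Zpos 7262382, 22%N); (Zpos 927493, 18%N);
     (Zpos 915352, 38%N); (Zpos 1824633, 42%N); (Zpos 236935, 38%N);
     (Zpos 113069, 18%N); (Zpos 441174, 26%N); (Zpos 41366, 18%N);
     (Zpos 56833, 22%N); (Zpos 358905, 14%N); (Zpos 184472, 42%N);
     (Zpos 81906, 24%N); (Zpos 1682778, 26%N); (Zpos 70433, 16%N)].

(** The same for x = 3, 4, ... and y = 1. *)
Definition table_pos : seq (Z * nat) :=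
 [:: (Zpos 91512, 60%N); (Zpos 64872, 36%N); (Zpos 36627, 30%N);
     (Zpos 14280, 24%N); (Zpos 61093, 22%N); (Zpos 242047, 14%N);
     (Zpos 2160, 12%N); (Zpos 32043, 18%N); (Zpos 14279, 10%N);
     (Zpos 12929, 14%N); (Zpos 28055, 10%N); (Zpos 24553, 22%N);
     (Zpos 2664, 12%N); (Zpos 2720, 12%N); (Zpos 4896, 12%N);
     (Zpos 2907, 12%N); (Zpos 4560, 12%N)].

Definition table_ok (Y : Z) (x0 : nat) (t : seq (Z * nat)) : bool :=
  all (fun i => certified (Z.of_nat (x0 + i)) Y (nth (Z0, 0%N) t i)) (iota 0 (size t)).

Lemma tables_ok : table_ok (Zneg xH) 2 table_neg && table_ok (Zpos xH) 3 table_pos.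
Proof. by vm_compute. Qed.

Definition residue (M : Z) (v : int) : Z := Z.modulo (Z_of_int v) M.

Lemma residueM M u v : residue M (u * v) = Z.modulo (Z.mul (residue M u) (residue M v)) M.
Proof.
rewrite /residue -Zmult_mod; congr Z.modulo; lia.
Qed.

Lemma residue_step M x y u v :
  residue M (x * u - y * v)
  = Z.modulo (Z.sub (Z.mul (Z_of_int x) (residue M u)) (Z.mul (Z_of_int y) (residue M v))) M.
Proof.
rewrite /residue Zminus_mod !Zmult_mod_idemp_r -Zminus_mod; congr Z.modulo; lia.
Qed.

Lemma lucas_residuesP M x y m T :
  lucas_residues M (Z_of_int x) (Z_of_int y)
    (residue M (lucasU x y m)) (residue M (lucasU x y m.+1)) T
  = [seq residue M (lucasU x y i) | i <- iota m T].
Proof.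
elim: T m => [|T IH] m //.
have := IH m.+1; rewrite lucasUSS residue_step => {}IH.
by rewrite [iota _ _]/= map_cons -IH.
Qed.

Lemma mul_rowsP M (I : Type) (f g : I -> int) (s : seq I) :
  mul_rows M [seq residue M (f i) | i <- s] [seq residue M (g i) | i <- s]
  = [seq residue M (f i * g i) | i <- s].
Proof.
by elim: s => [|i s IH] //; rewrite /mul_rows /= residueM -IH.
Qed.

Lemma power_rowsP M (f : nat -> int) (s : seq nat) j q :
  power_rows M [seq residue M (f i) | i <- s] [seq residue M (f i ^+ j) | i <- s] q
  = [seq [seq residue M (f i ^+ p) | i <- s] | p <- iota j q].
Proof.
elim: q j => [|q IH] j //=; rewrite mul_rowsP -IH; congr (_ :: power_rows _ _ _ _).
by apply: eq_map => i; rewrite exprS.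
Qed.

Lemma mem_residue_set z l : z \in l -> PositiveSet.mem (key z) (residue_set l).
Proof.
elim: l => [|u l IH] //; rewrite inE => zul; apply/PositiveSet.mem_spec.
apply/PositiveSet.add_spec; case/orP: zul => [/eqP->|/IH h]; [left|right] => //.
Qed.

Lemma sums_avoid_cons M L k S u l : sums_avoid M L k S (u :: l)
  = (Z.ltb k 3 || ~~ PositiveSet.mem (key (Z.modulo (Z.add S (Z.mul k u)) M)) L)
    && sums_avoid M L (Z.succ k) (Z.add S (Z.mul k u)) l.
Proof. by []. Qed.

Lemma sums_avoidP M L x y p k S n :
  Z.modulo S M = residue M (power_sum x y p k) ->
  sums_avoid M L (Z.of_nat k.+1) S [seq residue M (lucasU x y i ^+ p) | i <- iota k.+1 n] ->
  forall j, (k < j <= k + n)%N -> (3 <= j)%N ->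
  ~~ PositiveSet.mem (key (residue M (power_sum x y p j))) L.
Proof.
elim: n k S => [|n IH] k S SE.
  by move=> _ j; rewrite addn0 => /andP[h1 h2]; move: (leq_trans h1 h2); rewrite ltnn.
rewrite -[iota k.+1 n.+1]/(k.+1 :: iota k.+2 n) map_cons sums_avoid_cons.
set S' := Z.add _ _.
have SE' : Z.modulo S' M = residue M (power_sum x y p k.+1).
  rewrite /S' power_sumS Zplus_mod SE /residue Zmult_mod_idemp_r -Zplus_mod.
  by congr Z.modulo; lia.
move=> /andP[h1 h2] j /andP[kj jn] j3.
have [jk|jk] := eqVneq j k.+1.
  by move: h1; rewrite SE' -jk => /orP[] //; lia.
apply: (IH k.+1 S' SE') => //; first by rewrite Nat2Z.inj_succ.
by rewrite ltn_neqAle eq_sym jk kj addSnnS.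
Qed.

Lemma nth_flatten_nseq (T : Type) (d : T) (s : seq T) c i : (i < c * size s)%N ->
  nth d (flatten (nseq c s)) i = nth d s (i %% size s).
Proof.
elim: c i => [|c IH] i //; rewrite mulSn /= nth_cat => h.
case: ltnP => h1; first by rewrite modn_small.
rewrite IH; last by rewrite ltn_subLR.
by rewrite -{2}(subnK h1) modnDr.
Qed.

Lemma lucasU_residue_period M x y T :
  residue M (lucasU x y T) = residue M 0 -> residue M (lucasU x y T.+1) = residue M 1 ->
  forall n, residue M (lucasU x y n) = residue M (lucasU x y (n %% T)).
Proof.
move=> h0 h1.
have per n : residue M (lucasU x y (n + T)) = residue M (lucasU x y n)
    /\ residue M (lucasU x y (n.+1 + T)) = residue M (lucasU x y n.+1).
  elim: n => [|n [IH0 IH1]] //; split=> //.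
  by rewrite !addSn !lucasUSS -addSn !residue_step IH0 IH1.
move=> n; rewrite {1}(divn_eq n T) addnC; elim: (n %/ T)%N => [|c IH].
  by rewrite mul0n addn0.
by rewrite mulSn addnCA addnC (per _).1.
Qed.

Lemma residueX M u v q : residue M u = residue M v -> residue M (u ^+ q) = residue M (v ^+ q).
Proof.
by move=> h; elim: q => [|q IH] //; rewrite !exprS !residueM h IH.
Qed.

Lemma certifiedP x y c p q k n : certified (Z_of_int x) (Z_of_int y) c ->
  (0 < p <= 11)%N -> (0 < q <= 11)%N -> (3 <= k)%N -> (k <= 240 %/ p + p)%N ->
  power_sum x y p k <> lucasU x y n ^+ q.
Proof.
case: c => M T; rewrite /certified [(M, T).1]/= [(M, T).2]/=.
case/and4P=> M1 T10 per chk p11 q11 k3 kK E.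
have M1' : Z.lt 1 M by apply/Z.ltb_lt.
have r0 : residue M 0 = Z0 by rewrite /residue Z.mod_0_l //; lia.
have r1 : residue M 1 = Zpos xH by rewrite /residue Z.mod_1_l.
have rE : lucas_residues M (Z_of_int x) (Z_of_int y) Z0 (Zpos xH) T.+2
  = [seq residue M (lucasU x y i) | i <- iota 0 T.+2].
  by rewrite -lucas_residuesP -r0 -r1.
rewrite rE in per chk.
have takeE : take T [seq residue M (lucasU x y i) | i <- iota 0 T.+2]
    = [seq residue M (lucasU x y i) | i <- iota 0 T].
  by rewrite -map_take take_iota (minn_idPl _) // -addn2 leq_addr.
rewrite takeE in chk.
have {}per : forall n, residue M (lucasU x y n) = residue M (lucasU x y (n %% T)).
  move: per; rewrite -map_drop drop_iota add0n subSn ?leqnSn // subSnn /=.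
  move=> /andP[/Z.eqb_spec e0 /Z.eqb_spec e1].
  by apply: lucasU_residue_period; rewrite ?r0 ?r1.
set base := [seq residue M (lucasU x y i) | i <- iota 0 T] in chk.
have rowsE : power_rows M base base 11
    = [seq [seq residue M (lucasU x y i ^+ j) | i <- iota 0 T] | j <- iota 1 11].
  by rewrite -power_rowsP; congr power_rows; apply: eq_map => i; rewrite expr1.
rewrite rowsE in chk; set rows := [seq _ | j <- iota 1 11] in chk.
have inL : PositiveSet.mem (key (residue M (lucasU x y n ^+ q))) (residue_set (flatten rows)).
  apply: mem_residue_set; rewrite (residueX _ (per n)); apply/flattenP.
  exists [seq residue M (lucasU x y i ^+ q) | i <- iota 0 T].
    apply: (map_f (fun j => [seq residue M (lucasU x y i ^+ j) | i <- iota 0 T])).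
    by rewrite mem_iota add1n ltnS.
  apply: (map_f (fun i => residue M (lucasU x y i ^+ q))).
  by rewrite mem_iota /= add0n ltn_mod; apply: leq_trans T10.
pose row := [seq residue M (lucasU x y i ^+ p) | i <- iota 0 T].
have row_in : (p, row) \in zip (iota 1 11) rows.
  apply/(nthP (0%N, [::])); exists p.-1.
    by rewrite size_zip size_map size_iota minnn prednK; case/andP: p11.
  have p1 : (p.-1 < 11)%N by case/andP: p11; lia.
  rewrite nth_zip ?size_map // nth_iota // (nth_map 0%N) ?size_iota // nth_iota //.
  by rewrite add1n prednK //; case/andP: p11.
have := allP chk _ row_in; rewrite [(_, _).1]/= [(_, _).2]/=.
set K := (240 %/ p + p)%N in kK *.
have K_lt : (K < 26 * T)%N.
  have : (240 %/ p <= 240)%N by apply: leq_div.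
  by rewrite /K; case/andP: p11; move: T10 (240 %/ p)%N; clear; lia.
have sz : size row = T by rewrite size_map size_iota.
have -> : take K (behead (flatten (nseq 26 row)))
    = [seq residue M (lucasU x y i ^+ p) | i <- iota 1 K].
  have szf : size (flatten (nseq 26 row)) = (26 * T)%N.
    by rewrite size_flatten /shape map_nseq sumn_nseq sz mulnC.
  have szt : size (take K (behead (flatten (nseq 26 row)))) = K.
    by rewrite size_takel // size_behead szf; move: K_lt; clear; lia.
  apply: (@eq_from_nth _ Z0); first by rewrite szt size_map size_iota.
  rewrite szt => i iK; rewrite nth_take // nth_behead nth_flatten_nseq ?sz; last first.
    by apply: leq_ltn_trans K_lt.
  have T0 : (0 < T)%N by apply: leq_trans T10.
  rewrite /row (nth_map 0%N) ?size_iota ?ltn_mod // nth_iota ?ltn_mod // add0n.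
  rewrite (nth_map 0%N) ?size_iota // nth_iota // add1n.
  by apply: residueX; rewrite -per.
move=> /(sums_avoidP (k := 0)) h; have {}h := h ltac:(by rewrite /power_sum big_geq // r0 Z.mod_0_l //; lia).
have := h k _ k3; rewrite add0n kK (leq_trans _ k3) // => /(_ isT).
by rewrite E inL.
Qed.

Lemma no_small_x (x y : int) (p q k n : nat) : lucas_range x y -> x < 20 ->
  (0 < p <= 11)%N -> (0 < q <= 11)%N -> (3 <= k)%N -> (k <= 240 %/ p + p)%N ->
  power_sum x y p k <> lucasU x y n ^+ q.
Proof.
move=> xy x20 p11 q11 k3 kK; have /andP[tn tp] := tables_ok.
have Zx (x0 i : nat) : x = (x0 + i)%:Z -> Z.of_nat (x0 + i) = Z_of_int x by move=> ->; lia.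
case: xy => -[yE xge]; rewrite yE.
  have i_in : (`|x| - 2)%N \in iota 0 (size table_neg) by rewrite mem_iota /=; lia.
  have := allP tn _ i_in; rewrite (Zx 2%N); last by lia.
  have -> : Zneg xH = Z_of_int (-1) by [].
  by move=> h; apply: (certifiedP h).
have i_in : (`|x| - 3)%N \in iota 0 (size table_pos) by rewrite mem_iota /=; lia.
have := allP tp _ i_in; rewrite (Zx 3%N); last by lia.
have -> : Zpos xH = Z_of_int 1 by [].
by move=> h; apply: (certifiedP h).
Qed.

(** * Conclusion *)

Theorem theorem1p1 :
  (forall (n p q : nat) (x y : int),
     (0 < n)%N -> (0 < p)%N -> (0 < q)%N -> 0 < x ->
     y = 1 \/ y = -1 ->
     (1 + 2 * x ^+ p = lucasU x y n ^+ q <->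
          (n, p, q, x, y) = (4%N, p, 1%N, 1, -1) \/
          (n, p, q, x, y) = ((1 + 2 ^ (p + 1))%N, p, 1%N, 2, 1) \/
          (n, p, q, x, y) = (3%N, 2%N, 2%N, 2, 1) \/
          (n, p, q, x, y) = (3%N, 1%N, 1%N, 2, -1) \/
          (n, p, q, x, y) = (5%N, 3%N, 1%N, 3, 1)))
  /\
  (forall (n k p q : nat) (x y : int),
     (0 < n)%N -> (0 < p)%N -> (0 < q)%N -> 0 < x ->
     (maxn p q <= 11)%N -> (3 <= k)%N ->
     y = 1 \/ y = -1 ->
     (y = -1 -> 2 <= x) -> (y = 1 -> 3 <= x) ->
     \sum_(1 <= j < k.+1) j%:Z * lucasU x y j ^+ p <> lucasU x y n ^+ q).
Proof.
split; first by move=> n p q x y n0 p0 q0 x0 y1; apply: power_eq_solutions.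
move=> n k p q x y n0 p0 q0 x0 pq11 k3 y1 xn xp.
have xy : lucas_range x y by case: y1 => y1; [right|left]; split=> //; [exact: xp|exact: xn].
rewrite geq_max in pq11; case/andP: pq11 => p11 q11.
rewrite -/(power_sum x y p k) => eqS.
have [kK large] := power_sum_eq_constraints xy p0 q0 p11 q11 k3 n0 eqS.
have [x20|x20] := ltrP x 20.
  by apply: (no_small_x xy x20 _ _ k3 kK eqS); rewrite ?p0 ?q0.
have [nk kx] := large x20.
exact: (no_large_x xy x20 p0 q0 p11 nk kx eqS).
Qed.
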